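(* Let $(M,F=\alpha^2/\beta)$ be a Kropina space of $p$-scalar flag curvature $K=K(x)$ and let $(h,W)$ be the navigation data of $F$. Then $(M,F)$ is a Berwald space, that is, ${W^i}_{||j}=0$, if and only if $K(x)=0$ identically on $M$.
   Context: Kropina space: $M$ is an $n$-dimensional differentiable manifold ($n\ge2$, so that flag curvature makes sense), $\alpha=\sqrt{a_{ij}(x)y^iy^j}$ is a Riemannian metric on $M$, $\beta=b_i(x)y^i$ is a nowhere vanishing 1-form, and $F=\alpha^2/\beta$ is regarded as a conic Finsler metric on the domain $\{(x,y)\in TM:\beta(x,y)>0\}$. Navigation data: with $b^2:=a^{ij}b_ib_j$ ($(a^{ij})$ the inverse matrix of $(a_{ij})$), let $\kappa=\kappa(x)$ be the function on $M$ defined by $e^{\kappa}b^2=4$, and put $h_{ij}:=e^{\kappa}a_{ij}$, $2W_i:=e^{\kappa}b_i$, $W^i:=h^{ij}W_j$, where $(h^{ij})$ is the inverse matrix of $(h_{ij})$. Then $h=\sqrt{h_{ij}y^iy^j}$ is a Riemannian metric and $W=W^i\,\partial/\partial x^i$ is a vector field of constant $h$-length $1$; $(h,W)$ is called the navigation data of $F$. The symbol $||$ denotes the covariant derivative with respect to the Levi-Civita connection of $h$. Let $G^i=\frac14 g^{il}\left(\frac{\partial^2F^2}{\partial x^k\partial y^l}y^k-\frac{\partial F^2}{\partial x^l}\right)$, $g_{ij}=\frac12\frac{\partial^2F^2}{\partial y^i\partial y^j}$, be the geodesic spray coefficients of $F$. $(M,F)$ is a Berwald space if $\frac{\partial^3G^i}{\partial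 y^j\partial y^k\partial y^l}=0$ for all indices. Flag curvature: let ${R^i}_k=2\frac{\partial G^i}{\partial x^k}-y^j\frac{\partial^2G^i}{\partial x^j\partial y^k}+2G^j\frac{\partial^2G^i}{\partial y^j\partial y^k}-\frac{\partial G^i}{\partial y^j}\frac{\partial G^j}{\partial y^k}$. The (conic) Finsler space $(M,F)$ is of scalar flag curvature $K=K(x,y)$ if ${R^i}_k=K(x,y)\left(F^2\delta^i_k-F\frac{\partial F}{\partial y^k}y^i\right)$ on the domain of $F$. It is of $p$-scalar flag curvature if in addition $K(x,y)=K(x)$ is independent of $y$. *)

(* Defs.v *)
From HB Require Import structures.
From mathcomp Require Import all_boot all_order all_algebra.
From mathcomp Require Import all_classical all_reals all_analysis.
Set Implicit Arguments.
Unset Strict Implicit.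
Unset Printing Implicit Defensive.
Import Order.TTheory GRing.Theory Num.Theory.
Import numFieldNormedType.Exports.
Local Open Scope classical_set_scope.
Local Open Scope ring_scope.

Section PartialDerivatives.
Context {R : realType} {n : nat}.
Implicit Types (f : 'rV[R]_n -> R) (x : 'rV[R]_n).

Definition pd (k : 'I_n) f x : R := 'D_(delta_mx 0 k) f x.

Definition iter_pd (s : seq 'I_n) f : 'rV[R]_n -> R := foldr pd f s.

(* C^oo: on an open set, Frechet differentiability of all iterated partial
   derivatives is the same as their existence and continuity. *)
Definition smooth_on (U : set 'rV[R]_n) f :=
  forall (s : seq 'I_n) x, U x -> differentiable (iter_pd s f) x.

End PartialDerivatives.

(* The atlas is an arbitrary smooth atlas (not required to be maximal).
   [coord i] and [point i] are the i-th chart and its inverse; as total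
   functions they are meaningful only on [dom i] and [coord i @` dom i]. *)
Record smoothManifold (R : realType) (n : nat) := SmoothManifold {
  carrier :> topologicalType;
  carrier_hausdorff : hausdorff_space carrier;
  carrier_countable : @second_countable carrier;
  chart : Type;
  dom : chart -> set carrier;
  coord : chart -> carrier -> 'rV[R]_n;
  point : chart -> 'rV[R]_n -> carrier;
  dom_open : forall i, open (dom i);
  img_open : forall i, open (coord i @` dom i);
  dom_cover : forall p, exists i, dom i p;
  coordK : forall i p, dom i p -> point i (coord i p) = p;
  coord_continuous : forall i p, dom i p -> {for p, continuous (coord i)};
  point_continuous : forall i x, (coord i @` dom i) x ->
    {for x, continuous (point i)};
  transition_smooth : forall i j k,
    smooth_on (coord i @` (dom i `&` dom j))
      (fun x => coord j (point i x) 0 k)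
}.

Section Tensors.
Context {R : realType} {n : nat} (M : smoothManifold R n).

Definition chart_img (i : chart M) : set 'rV[R]_n := coord i @` dom i.

Definition overlap (i j : chart M) : set 'rV[R]_n :=
  coord i @` (dom i `&` dom j).

Definition transition (i j : chart M) (x : 'rV[R]_n) : 'rV[R]_n :=
  coord j (point i x).

(* Tensor fields are given by their components in each chart.  The library's
   jacobian acts on row vectors from the right: its (k, l) entry is the
   derivative of the l-th new coordinate along the k-th old one. *)
Record riemannianMetric := RiemannianMetric {
  metric :> chart M -> 'rV[R]_n -> 'M[R]_n;
  metric_smooth : forall i k l, smooth_on (chart_img i)
    (fun x => metric i x k l);
  metric_sym : forall i x, chart_img i x -> (metric i x)^T = metric i x;
  metric_posdef : forall i x, chart_img i x -> forall y : 'rV[R]_n,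
    y != 0 -> 0 < \sum_k \sum_l metric i x k l * y 0 k * y 0 l;
  metric_change : forall i j x, overlap i j x ->
    metric i x = jacobian (transition i j) x
      *m metric j (transition i j x) *m (jacobian (transition i j) x)^T
}.

Record oneForm := OneForm {
  form :> chart M -> 'rV[R]_n -> 'rV[R]_n;
  form_smooth : forall i k, smooth_on (chart_img i) (fun x => form i x 0 k);
  form_change : forall i j x, overlap i j x ->
    form i x = form j (transition i j x) *m (jacobian (transition i j) x)^T
}.

Definition nowhere_vanishing (b : oneForm) :=
  forall i x, chart_img i x -> b i x != 0.

End Tensors.

Section LocalFinsler.
Context {R : realType} {n : nat}.
Variable F : 'rV[R]_n -> 'rV[R]_n -> R.
Implicit Types (i j k l : 'I_n) (x y : 'rV[R]_n).

Definition fundamental_tensor x y : 'M[R]_n :=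
  \matrix_(i, j)
    (2^-1 * pd i (fun y1 => pd j (fun y2 => F x y2 ^+ 2) y1) y).

Definition spray i x y : R :=
  4^-1 * \sum_l invmx (fundamental_tensor x y) i l *
    ((\sum_k pd k (fun x1 => pd l (fun y1 => F x1 y1 ^+ 2) y) x * y 0 k)
     - pd l (fun x1 => F x1 y ^+ 2) x).

Definition riemann_curvature i k x y : R :=
  2 * pd k (fun x1 => spray i x1 y) x
  - \sum_j y 0 j * pd j (fun x1 => pd k (fun y1 => spray i x1 y1) y) x
  + 2 * \sum_j spray j x y *
      pd j (fun y1 => pd k (fun y2 => spray i x y2) y1) y
  - \sum_j pd j (fun y1 => spray i x y1) y * pd k (fun y1 => spray j x y1) y.

Definition berwald_on (D : set ('rV[R]_n * 'rV[R]_n)) :=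
  forall x y, D (x, y) -> forall i j k l,
    pd j (fun y1 => pd k (fun y2 => pd l (fun y3 => spray i x y3) y2) y1) y
    = 0.

Definition scalar_flag_curvature_on (D : set ('rV[R]_n * 'rV[R]_n))
    (K : 'rV[R]_n -> 'rV[R]_n -> R) :=
  forall x y, D (x, y) -> forall i k,
    riemann_curvature i k x y =
    K x y * (F x y ^+ 2 * (i == k)%:R
             - F x y * pd k (fun y1 => F x y1) y * y 0 i).

End LocalFinsler.

Section LocalKropina.
Context {R : realType} {n : nat}.
Variables (a : 'rV[R]_n -> 'M[R]_n) (b : 'rV[R]_n -> 'rV[R]_n).
Implicit Types (i j k l : 'I_n) (x y : 'rV[R]_n).

Definition alpha x y : R :=
  Num.sqrt (\sum_i \sum_j a x i j * y 0 i * y 0 j).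

Definition beta x y : R := \sum_i b x 0 i * y 0 i.

Definition kropina x y : R := alpha x y ^+ 2 / beta x y.

Definition sqnorm_b x : R :=
  \sum_i \sum_j invmx (a x) i j * b x 0 i * b x 0 j.

Definition kappa x : R := ln (4 / sqnorm_b x).

Lemma kappaE x : 0 < sqnorm_b x -> expR (kappa x) * sqnorm_b x = 4.
Proof.
move=> b_gt0; rewrite /kappa lnK ?posrE ?divr_gt0 ?ltr0n//.
by rewrite divfK// gt_eqF.
Qed.

Definition nav_metric x : 'M[R]_n := expR (kappa x) *: a x.

Definition nav_form x : 'rV[R]_n := (expR (kappa x) / 2) *: b x.

Definition nav_field x : 'rV[R]_n :=
  \row_i \sum_j invmx (nav_metric x) i j * nav_form x 0 j.

End LocalKropina.

Section LeviCivita.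
Context {R : realType} {n : nat}.
Variable h : 'rV[R]_n -> 'M[R]_n.

Definition christoffel (i j k : 'I_n) (x : 'rV[R]_n) : R :=
  2^-1 * \sum_l invmx (h x) i l *
    (pd j (fun x1 => h x1 l k) x + pd k (fun x1 => h x1 l j) x
     - pd l (fun x1 => h x1 j k) x).

Definition cov_derivative (W : 'rV[R]_n -> 'rV[R]_n) (i j : 'I_n)
    (x : 'rV[R]_n) : R :=
  pd j (fun x1 => W x1 0 i) x + \sum_k christoffel i j k x * W x 0 k.

End LeviCivita.

Section KropinaSpace.
Context {R : realType} {n : nat} (M : smoothManifold R n).
Variables (a : riemannianMetric M) (b : oneForm M).

Definition kropina_domain (c : chart M) : set ('rV[R]_n * 'rV[R]_n) :=
  [set z | chart_img c z.1 /\ 0 < beta (b c) z.1 z.2].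

Definition kropina_berwald :=
  forall c, berwald_on (kropina (a c) (b c)) (kropina_domain c).

Definition kropina_p_scalar_flag_curvature (K : M -> R) :=
  forall c, scalar_flag_curvature_on (kropina (a c) (b c)) (kropina_domain c)
    (fun x _ => K (point c x)).

Definition nav_field_parallel :=
  forall c x, chart_img c x -> forall i j,
    cov_derivative (nav_metric (a c) (b c)) (nav_field (a c) (b c)) i j x = 0.

End KropinaSpace.

(* Main.v *)
Require Import Defs.
From mathcomp Require Import all_boot all_order all_algebra.
From mathcomp Require Import all_classical all_reals all_analysis.
From mathcomp Require Import ring lra.
Set Implicit Arguments.
Unset Strict Implicit.
Unset Printing Implicit Defensive.
Import Order.TTheory GRing.Theory Num.Theory.
Import numFieldNormedType.Exports.
Local Open Scope classical_set_scope.
Local Open Scope ring_scope.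

(** Let h be the metric and W the unit vector field of the navigation data, and
    write w = W(y), H = h(y,y) and D for the covariant derivative of the 1-form
    W, so that D(u,v) is u^l v^j W_{l||j}.  On the domain w > 0 the Kropina metric
    is F = H / (2w), and solving the Euler-Lagrange equations for F gives its
    spray (lemma [spray_Fnav]):

      2 G = Gamma(y,y) + r (y - F W) - F s,   r = D(y,W) - D(y,y) / F,

    where Gamma is the Christoffel form of h and s is the vector dual to the
    covector z |-> D(z,y) - D(y,z).  Everything is rational in y, with w and H as
    the only denominators.  The curvature equation is examined at one point x
    along the lines y = W + t v with v orthogonal to W: there w = 1, while H is
    1 + t^2 |v|^2, so that all quantities become rational functions of t whose
    only poles are the zeros of H.

    W is a Killing field ([covW_alt]).  The part of G with denominator H is P y
    with P = - w D(y,y) / H.  A change of spray by a multiple of y is a projective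
    change, which modifies the curvature in a simple way ([curv_projective]), and
    after contraction with a covector that annihilates y, the double pole of the
    curvature is 3 (w D(y,y))^2 / H^2 ([pole_equation]).  The right-hand side
    K F^2 has no pole at H = 0.  Hence 1 + t^2 |v|^2 divides
    D(W + t v, W + t v)^2, a polynomial in t in which W contributes no term
    D(W,W) because W has constant length; this forces D(y,y) = 0 for all y.

    K measures the covariant derivative of W ([flag_curvature_sigma]).  For a Killing field of constant length
    G = Gamma(y,y) / 2 - F sigma(y), where sigma is the skew-symmetric
    endomorphism given by the covariant derivative of W, and sigma(W) = 0.  The
    component of the curvature equation along v in both slots is polynomial in t;
    its coefficient of t^4 says that |sigma v|^2 = K |v|^2.

    Conclusion.  Since n >= 2 there is a nonzero v orthogonal to W, so K(x) = 0 if
    and only if sigma = 0, that is, D = 0 at x ([flag0_parallel],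
    [parallel_flag0]).  If D = 0 everywhere, then G = Gamma(y,y) / 2 is quadratic
    in y.  Conversely, the third derivative of G at y = W in the direction v is
    - 3 |v|^2 sigma(v), so that a Berwald space has sigma = 0
    ([cubic_free_parallel]). *)

(** * Partial derivatives of rational expressions on a conic domain *)

(** Openness is asked separately in x and in y because every derivative that
    occurs is a partial one, taken with the other variable frozen. *)
Record conicDomain (R : realType) (n : nat) := ConicDomain {
  base : set 'rV[R]_n;
  cone :> 'rV[R]_n -> 'rV[R]_n -> Prop;
  cone_base : forall x y, cone x y -> base x;
  cone_nearx : forall x y, cone x y -> \forall x' \near x, cone x' y;
  cone_neary : forall x y, cone x y -> \forall y' \near y, cone x y'
}.

Section Calculus.
Context {R : realType} {n : nat} {D : conicDomain R n}.
Notation V := 'rV[R]_n.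
Notation U := (base D).
Implicit Types (f g : V -> V -> R) (x y z v : V) (s : bool) (k : 'I_n).

Definition eq_dom f g := forall x y, D x y -> f x y = g x y.

(** The expressions built from smooth functions of x and the coordinates of y
    by ring operations and by inversion of the functions selected by J, up to
    equality on the domain.  Being generated by finitely many rules, the class
    is closed under partial derivatives by induction, and suitable choices of J
    control where the expressions may have poles. *)
Inductive reg (J : (V -> V -> R) -> Prop) : (V -> V -> R) -> Prop :=
| reg_smooth c : smooth_on U c -> reg J (fun x _ => c x)
| reg_coord k : reg J (fun _ y => y 0 k)
| regD f g : reg J f -> reg J g -> reg J (fun x y => f x y + g x y)
| regM f g : reg J f -> reg J g -> reg J (fun x y => f x y * g x y)
| regV f : reg J f -> J f -> (forall x y, D x y -> f x y != 0) ->
    reg J (fun x y => (f x y)^-1)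
| reg_eq f g : reg J f -> eq_dom f g -> reg J g.

(** The flag s tells in which variable to differentiate: x if s holds, y
    otherwise. *)
Definition partial s k f x y : R :=
  if s then pd k (fun x1 => f x1 y) x else pd k (f x) y.

Definition has_partial s k f x y : Prop :=
  if s then derivable (fun x1 => f x1 y) x (delta_mx 0 k)
  else derivable (f x) y (delta_mx 0 k).

Lemma partial_eq s k f g : eq_dom f g -> eq_dom (partial s k f) (partial s k g).
Proof.
move=> fg x y Dxy; rewrite /partial /pd; case: s; apply: near_eq_derive.
  by near=> x1; apply: fg; near: x1; exact: cone_nearx.
by near=> y1; apply: fg; near: y1; exact: cone_neary.
Unshelve. all: by end_near. Qed.

Lemma has_partial_eq s k f g x y : D x y -> eq_dom f g ->
  has_partial s k f x y -> has_partial s k g x y.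
Proof.
move=> Dxy fg; rewrite /has_partial; case: s; apply: near_eq_derivable.
  by near=> x1; apply: fg; near: x1; exact: cone_nearx.
by near=> y1; apply: fg; near: y1; exact: cone_neary.
Unshelve. all: by end_near. Qed.

Lemma partial_cst s k (c : R) x y : partial s k (fun _ _ => c) x y = 0.
Proof. by rewrite /partial /pd; case: s; exact: derive_cst. Qed.

Lemma is_derive_coord k i (y : V) :
  is_derive y (delta_mx 0 k) (fun y : V => y 0 i : R^o) (k == i)%:R.
Proof.
have dif : differentiable (fun y : V => y 0 i : R^o) y.
  exact: differentiable_coord.
apply: DeriveDef; first exact: diff_derivable.
rewrite /derive; apply: cvg_lim => //.
apply: cvg_near_cst; near=> h.
rewrite /= !mxE eqxx/= addrK [_ *: _]mulKf//; last by near: h; exact: nbhs_dnbhs_neq.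
by rewrite eq_sym.
Unshelve. all: by end_near. Qed.

Lemma partial_coord s k i x y :
  partial s k (fun _ y => y 0 i) x y = if s then 0 else (k == i)%:R.
Proof.
rewrite /partial /pd; case: s; first exact: derive_cst.
by have := is_derive_coord k i y; move=> [_ ->].
Qed.

Lemma has_partial_coord s k i x y : has_partial s k (fun _ y => y 0 i) x y.
Proof.
rewrite /has_partial; case: s; first exact: derivable_cst.
by have := is_derive_coord k i y; move=> [].
Qed.

Lemma has_partialD s k f g x y : has_partial s k f x y -> has_partial s k g x y ->
  has_partial s k (fun x y => f x y + g x y) x y.
Proof. by rewrite /has_partial; case: s => df dg; have := derivableD df dg. Qed.

Lemma partialD s k f g x y : has_partial s k f x y -> has_partial s k g x y ->
  partial s k (fun x y => f x y + g x y) x y = partial s k f x y + partial s k g x y.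
Proof. by rewrite /has_partial /partial /pd; case: s => df dg; have :=
  deriveD df dg. Qed.

Lemma has_partialM s k f g x y : has_partial s k f x y -> has_partial s k g x y ->
  has_partial s k (fun x y => f x y * g x y) x y.
Proof. by rewrite /has_partial; case: s => df dg; have := derivableM df dg. Qed.

Lemma partialM s k f g x y : has_partial s k f x y -> has_partial s k g x y ->
  partial s k (fun x y => f x y * g x y) x y =
  partial s k f x y * g x y + f x y * partial s k g x y.
Proof.
rewrite /has_partial /partial /pd addrC; case: s => df dg; have := deriveM df dg;
  by rewrite [X in _ = _ + X]mulrC.
Qed.

Lemma has_partialV s k f x y : f x y != 0 -> has_partial s k f x y ->
  has_partial s k (fun x y => (f x y)^-1) x y.
Proof. by rewrite /has_partial; case: s => df dg; exact: derivableV. Qed.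

Lemma partialV s k f x y : f x y != 0 -> has_partial s k f x y ->
  partial s k (fun x y => (f x y)^-1) x y =
  - (f x y)^-1 * (f x y)^-1 * partial s k f x y.
Proof.
rewrite /has_partial /partial /pd; case: s => f0 df; rewrite [LHS]deriveV//;
  by rewrite expr2 invfM mulNr.
Qed.

(** [smooth_on] quantifies over all words of derivatives, so a derivative taken
    first is just a longer word. *)
Lemma smooth_on_pd c k : smooth_on U c -> smooth_on U (pd k c).
Proof.
move=> cU q x Ux; have := cU (rcons q k) x Ux.
by rewrite /iter_pd -cats1 foldr_cat.
Qed.

Lemma has_partial_smooth s k c x y : smooth_on U c -> U x ->
  has_partial s k (fun x _ => c x) x y.
Proof.
move=> cU Ux; rewrite /has_partial; case: s; last exact: derivable_cst.
exact/diff_derivable/(cU [::]).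
Qed.

Lemma reg_cst J (c : R) : reg J (fun _ _ => c).
Proof.
apply: (@reg_smooth J (fun=> c)) => q x _.
suff -> : iter_pd q (fun=> c) = fun=> (if q is [::] then c else 0 : R).
  exact: differentiable_cst.
elim: q => [//|k q IH]; rewrite /iter_pd /= -/(iter_pd q (fun=> c)) IH.
by apply/funext => z; exact: derive_cst.
Qed.

Lemma regN J f : reg J f -> reg J (fun x y => - f x y).
Proof.
move=> rf; apply: reg_eq (regM (reg_cst J (-1)) rf) _ => x y _.
by rewrite mulN1r.
Qed.

Lemma regB J f g : reg J f -> reg J g -> reg J (fun x y => f x y - g x y).
Proof. by move=> rf rg; apply: regD rf (regN rg). Qed.

Lemma reg_sum J I (r : seq I) (P : pred I) (f : I -> V -> V -> R) :
  (forall i, P i -> reg J (f i)) ->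
  reg J (fun x y => \sum_(i <- r | P i) f i x y).
Proof.
move=> rf; elim: r => [|i r IH].
  by apply: reg_eq (reg_cst J 0) _ => x y _; rewrite big_nil.
have [Pi|nPi] := boolP (P i); last first.
  by apply: reg_eq IH _ => x y _; rewrite big_cons (negbTE nPi).
apply: reg_eq (regD (rf i Pi) IH) _ => x y _.
by rewrite big_cons Pi.
Qed.

Lemma reg_prod J I (r : seq I) (f : I -> V -> V -> R) :
  (forall i, reg J (f i)) ->
  reg J (fun x y => \prod_(i <- r) f i x y).
Proof.
move=> rf; elim: r => [|i r IH].
  by apply: reg_eq (reg_cst J 1) _ => x y _; rewrite big_nil.
by apply: reg_eq (regM (rf i) IH) _ => x y _; rewrite big_cons.
Qed.

Lemma reg_det J m (A : V -> V -> 'M[R]_m) :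
  (forall i j, reg J (fun x y => A x y i j)) -> reg J (fun x y => \det (A x y)).
Proof.
move=> rA; apply: reg_sum => p _; apply: regM; first exact: reg_cst.
by apply: reg_prod => i.
Qed.

Lemma reg_adj J m (A : V -> V -> 'M[R]_m) i j :
  (forall i j, reg J (fun x y => A x y i j)) ->
  reg J (fun x y => (\adj (A x y)) i j).
Proof.
move=> rA.
apply: (@reg_eq J (fun x y => cofactor (A x y) j i)); last first.
  by move=> x y _; rewrite !mxE.
apply: regM; first exact: reg_cst.
apply: reg_det => k l; apply: reg_eq (rA (lift j k) (lift i l)) _.
by move=> x y _; rewrite !mxE.
Qed.

Lemma reg_invmx J m (A : V -> 'M[R]_m) i j :
  (forall i j, reg J (fun x _ => A x i j)) -> J (fun x _ => \det (A x)) ->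
  (forall x y, D x y -> A x \in unitmx) -> reg J (fun x _ => invmx (A x) i j).
Proof.
move=> rA Jdet A_unit; have rd := reg_det (A := fun x _ => A x) rA.
have d0 x y : D x y -> \det (A x) != 0.
  by move=> /A_unit; rewrite unitmxE unitfE.
apply: reg_eq (regM (regV rd Jdet d0) (reg_adj i j (A := fun x _ => A x) rA)) _.
by move=> x y /A_unit Ux; rewrite /invmx Ux !mxE.
Qed.

Lemma reg_has_partial J s k f x y : reg J f -> D x y -> has_partial s k f x y.
Proof.
move=> rf; elim: rf x y => {f}
  [c cU|i|f g _ df _ dg|f g _ df _ dg|f _ df _ f0|f g _ df fg] x y Dxy.
- exact: has_partial_smooth (cone_base Dxy).
- exact: has_partial_coord.
- by apply: has_partialD; [exact: df|exact: dg].
- by apply: has_partialM; [exact: df|exact: dg].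
- by apply: has_partialV; [exact: f0|exact: df].
- by apply: has_partial_eq fg _ => //; exact: df.
Qed.

Lemma reg_partial J s k f : reg J f -> reg J (partial s k f).
Proof.
elim=> {f}
  [c cU|i|f g rf df rg dg|f g rf df rg dg|f rf df Jf f0|f g _ df fg].
- rewrite /partial; case: s; first exact/(@reg_smooth J (pd k c))/smooth_on_pd.
  by apply: reg_eq (reg_cst J 0) _ => x y _; rewrite /pd derive_cst.
- apply: reg_eq (reg_cst J (if s then 0 else (k == i)%:R)) _ => x y _.
  by rewrite partial_coord.
- apply: reg_eq (regD df dg) _ => x y Dxy.
  by rewrite partialD//; [exact: reg_has_partial rf Dxy|exact: reg_has_partial rg
    Dxy].
- apply: reg_eq (regD (regM df rg) (regM rf dg)) _ => x y Dxy.
  by rewrite partialM//; [exact: reg_has_partial rf Dxy|exact: reg_has_partial rg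
    Dxy].
- have ri := regV rf Jf f0.
  apply: reg_eq (regM (regN (regM ri ri)) df) _ => x y Dxy.
  rewrite partialV; [by rewrite !mulNr|exact: f0|exact: reg_has_partial rf Dxy].
- by apply: reg_eq df _; exact: partial_eq.
Qed.

Lemma reg_mono (J J' : (V -> V -> R) -> Prop) f :
  (forall f, J f -> J' f) -> reg J f -> reg J' f.
Proof.
move=> JJ'; elim=> {f}
  [c cU|i|f g _ rf _ rg|f g _ rf _ rg|f _ rf Jf f0|f g _ rf fg].
- exact: reg_smooth.
- exact: reg_coord.
- exact: regD.
- exact: regM.
- by apply: regV => //; exact: JJ'.
- exact: reg_eq fg.
Qed.

(** The directional derivative is known only through its defining equation, so
    that conversion never unfolds it into a sum of limits.  It is a sum of
    partial derivatives, hence linear in the direction without any Frechet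
    differentiability. *)
Fact dd_subproof : {d : bool -> V -> (V -> V -> R) -> V -> V -> R |
  forall s z f x y, d s z f x y = \sum_k z 0 k * partial s k f x y}.
Proof. by exists (fun s z f x y => \sum_k z 0 k * partial s k f x y). Qed.

Definition dd := sval dd_subproof.

Lemma ddE s z f x y : dd s z f x y = \sum_k z 0 k * partial s k f x y.
Proof. exact: (svalP dd_subproof). Qed.

Lemma dd_eq s z f g : eq_dom f g -> eq_dom (dd s z f) (dd s z g).
Proof.
by move=> fg x y Dxy; rewrite !ddE; apply: eq_bigr => k _;
  rewrite (partial_eq _ _ fg).
Qed.

Lemma ddD J s z f g x y : reg J f -> reg J g -> D x y ->
  dd s z (fun x y => f x y + g x y) x y = dd s z f x y + dd s z g x y.
Proof.
move=> rf rg Dxy; rewrite !ddE -big_split/=; apply: eq_bigr => k _.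
by rewrite partialD ?mulrDr//;
  [exact: reg_has_partial rf Dxy|exact: reg_has_partial rg Dxy].
Qed.

Lemma ddM J s z f g x y : reg J f -> reg J g -> D x y ->
  dd s z (fun x y => f x y * g x y) x y =
  dd s z f x y * g x y + f x y * dd s z g x y.
Proof.
move=> rf rg Dxy; rewrite !ddE mulr_suml mulr_sumr -big_split/=.
apply: eq_bigr => k _.
rewrite partialM; [|exact: reg_has_partial rf Dxy|exact: reg_has_partial rg Dxy].
by rewrite mulrDr mulrA; congr (_ + _); rewrite mulrCA.
Qed.

Lemma dd_cst s z (c : R) x y : dd s z (fun _ _ => c) x y = 0.
Proof. by rewrite ddE big1// => k _; rewrite partial_cst mulr0. Qed.

Lemma ddZ J s z c f x y : reg J f -> D x y ->
  dd s z (fun x y => c * f x y) x y = c * dd s z f x y.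
Proof.
by move=> rf Dxy; rewrite (ddM _ _ (reg_cst J c) rf Dxy) dd_cst mul0r add0r.
Qed.

Lemma dd_coord s z i x y :
  dd s z (fun _ y => y 0 i) x y = if s then 0 else z 0 i.
Proof.
rewrite ddE; case: s.
  by rewrite big1// => k _; rewrite partial_coord mulr0.
rewrite (bigD1 i)// partial_coord eqxx mulr1 big1; first exact: addr0.
by move=> k ki; rewrite partial_coord (negbTE ki) mulr0.
Qed.

Lemma dd_xonly z (c : V -> R) x y : dd false z (fun x _ => c x) x y = 0.
Proof. by rewrite ddE big1// => k _; rewrite /partial /pd derive_cst mulr0. Qed.

Lemma dd_sum J s z I (r : seq I) (f : I -> V -> V -> R) x y :
  (forall i, reg J (f i)) -> D x y ->
  dd s z (fun x y => \sum_(i <- r) f i x y) x y = \sum_(i <- r) dd s z (f i) x y.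
Proof.
move=> rf Dxy; elim: r => [|i r IH].
  rewrite big_nil -[RHS](dd_cst s z 0 x y); apply: dd_eq => // x1 y1 _.
  by rewrite big_nil.
rewrite big_cons -IH -(ddD _ _ (rf i) _ Dxy); last exact: reg_sum.
by apply: dd_eq => // x1 y1 _; rewrite big_cons.
Qed.

Lemma reg_dd J s z f : reg J f -> reg J (dd s z f).
Proof.
move=> rf; apply: reg_eq (reg_sum _ _) (fun x y _ => esym (ddE s z f x y)) => k _.
apply: regM; first exact: reg_cst.
exact: reg_partial.
Qed.

Lemma reg_ddv J s (z : V -> V -> V) f :
  (forall k, reg J (fun x y => z x y 0 k)) -> reg J f ->
  reg J (fun x y => dd s (z x y) f x y).
Proof.
move=> rz rf.
apply: reg_eq (reg_sum _ _) (fun x y _ => esym (ddE s (z x y) f x y)) => k _.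
by apply: regM => //; exact: reg_partial.
Qed.

Lemma dd_vD s u v f x y : dd s (u + v) f x y = dd s u f x y + dd s v f x y.
Proof.
by rewrite !ddE -big_split/=; apply: eq_bigr => k _; rewrite mxE mulrDl.
Qed.

Lemma dd_vZ s (a : R) v f x y : dd s (a *: v) f x y = a * dd s v f x y.
Proof.
by rewrite !ddE mulr_sumr; apply: eq_bigr => k _; rewrite mxE mulrA.
Qed.

Lemma dd_delta s k f x y : dd s (delta_mx 0 k) f x y = partial s k f x y.
Proof.
rewrite ddE (bigD1 k)// big1 => [|i ik].
  by rewrite mxE !eqxx mul1r; exact: addr0.
by rewrite mxE eqxx (negbTE ik) mul0r.
Qed.

End Calculus.
Arguments partial : simpl never.
Arguments reg {R n} D J f.
Arguments eq_dom {R n} D f g.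

Arguments dd_eq {R n D s z f g} _ {x y} _.
Arguments ddD {R n D J s z f g x y} _ _ _.
Arguments ddM {R n D J s z f g x y} _ _ _.
Arguments ddZ {R n D J s z c f x y} _ _.
Arguments dd_sum {R n D J s z I r f x y} _ _.

(** * Linear and bilinear forms in coordinates *)

Section FormsOfMatrices.
Context {R : realType} {n : nat}.
Implicit Types (A : 'M[R]_n) (p u v : 'rV[R]_n).

Definition bil A u v : R := (u *m A *m v^T) 0 0.
Definition lin p v : R := (p *m v^T) 0 0.

Lemma bilE A u v : bil A u v = \sum_k \sum_l A k l * u 0 k * v 0 l.
Proof.
rewrite /bil mxE exchange_big; apply: eq_bigr => l _.
rewrite !mxE mulr_suml; apply: eq_bigr => k _.
ring.
Qed.

Lemma linE p v : lin p v = \sum_k p 0 k * v 0 k.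
Proof. by rewrite /lin mxE; apply: eq_bigr => k _; rewrite mxE. Qed.

Lemma bilDl A u1 u2 v : bil A (u1 + u2) v = bil A u1 v + bil A u2 v.
Proof. by rewrite /bil !mulmxDl mxE. Qed.
Lemma bilDr A u v1 v2 : bil A u (v1 + v2) = bil A u v1 + bil A u v2.
Proof. by rewrite /bil linearD mulmxDr mxE. Qed.
Lemma bilZl A (c : R) u v : bil A (c *: u) v = c * bil A u v.
Proof. by rewrite /bil -!scalemxAl mxE. Qed.
Lemma bilZr A (c : R) u v : bil A u (c *: v) = c * bil A u v.
Proof. by rewrite /bil linearZ -scalemxAr mxE. Qed.
Lemma bilNl A u v : bil A (- u) v = - bil A u v.
Proof. by rewrite -scaleN1r bilZl mulN1r. Qed.
Lemma bilNr A u v : bil A u (- v) = - bil A u v.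
Proof. by rewrite -scaleN1r bilZr mulN1r. Qed.
Lemma bil0l A v : bil A 0 v = 0.
Proof. by rewrite /bil !mul0mx mxE. Qed.
Lemma bil0r A u : bil A u 0 = 0.
Proof. by rewrite /bil trmx0 mulmx0 mxE. Qed.
Lemma bilC A u v : A^T = A -> bil A u v = bil A v u.
Proof.
move=> sA; rewrite /bil.
transitivity ((u *m A *m v^T)^T 0 0); first by rewrite [RHS]mxE.
by rewrite !trmx_mul trmxK sA mulmxA.
Qed.
Definition bil_rules := (bilDl, bilDr, bilZl, bilZr, bilNl, bilNr, bil0l, bil0r).

Lemma linD p u v : lin p (u + v) = lin p u + lin p v.
Proof. by rewrite /lin linearD mulmxDr mxE. Qed.
Lemma linZ p (c : R) v : lin p (c *: v) = c * lin p v.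
Proof. by rewrite /lin linearZ -scalemxAr mxE. Qed.
Lemma linN p v : lin p (- v) = - lin p v.
Proof. by rewrite -scaleN1r linZ mulN1r. Qed.
Lemma lin0 p : lin p 0 = 0.
Proof. by rewrite /lin trmx0 mulmx0 mxE. Qed.
Lemma linDl p q v : lin (p + q) v = lin p v + lin q v.
Proof. by rewrite /lin mulmxDl mxE. Qed.
Lemma linZl p (c : R) v : lin (c *: p) v = c * lin p v.
Proof. by rewrite /lin -scalemxAl mxE. Qed.
Definition lin_rules := (linD, linZ, linN, lin0).

Lemma lin_mul u A v : lin (u *m A) v = bil A u v.
Proof. by []. Qed.

Lemma lin_inj p q : (forall v, lin p v = lin q v) -> p = q.
Proof.
move=> pq; apply/rowP => k; have := pq (delta_mx 0 k).
rewrite !linE (bigD1 k)//= [RHS](bigD1 k)//= !big1 ?addr0.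
- by rewrite !mxE !eqxx !mulr1.
- by move=> i /negbTE ik; rewrite mxE ik andbF mulr0.
- by move=> i /negbTE ik; rewrite mxE ik andbF mulr0.
Qed.

Lemma basis_expansion (f : 'rV[R]_n -> R) (z : 'rV[R]_n) : (forall u v,
  f (u + v) = f u + f v) ->
   (forall c u, f (c *: u) = c * f u) -> f z = \sum_k f (delta_mx 0 k) * z 0 k.
Proof.
move=> fD fZ; rewrite [in LHS](row_sum_delta z).
elim/big_ind2 : _ => [|_ a _ b <- <-|k _]; last by rewrite fZ mulrC.
  by rewrite -(scale0r 0) fZ mul0r.
by rewrite fD.
Qed.

Lemma linC p v : lin p v = lin v p.
Proof. by rewrite !linE; apply: eq_bigr => k _; rewrite mulrC. Qed.

Lemma lin_delta i u : lin (delta_mx 0 i) u = u 0 i.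
Proof. by rewrite /lin -rowE !mxE. Qed.

(** A kernel vector would be isotropic. *)
Lemma posdef_unit A : (forall y, y != 0 -> 0 < bil A y y) -> A \in unitmx.
Proof.
move=> A_gt0; rewrite -row_free_unit -kermx_eq0; apply/negPn/negP => K0.
have [i ri] : exists i, row i (kermx A) != 0.
  apply: contrapT => /forallNP F; move/eqP: K0; apply.
  by apply/row_matrixP => i; rewrite row0; apply/eqP/negPn/negP; exact: F.
have := A_gt0 _ ri; rewrite /bil -row_mul mulmx_ker row0 mul0mx mxE.
by rewrite ltxx.
Qed.

End FormsOfMatrices.

(** * Navigation data *)

(** Such a function is constant along a line whose direction is annihilated by
    W, so inverting it creates no pole there.  Functions of x alone and the form
    w itself are of this kind. *)
Definition ker_invariant {R : realType} {n : nat} (B : set 'rV[R]_n)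
    (W : 'rV[R]_n -> 'rV[R]_n) (f : 'rV[R]_n -> 'rV[R]_n -> R) :=
  forall x, B x -> forall y v, lin (W x) v = 0 -> f x (y + v) = f x y.

(** Indices are down: [Wcovec] is the 1-form W_i, whose length is measured with
    the inverse metric. *)
Record navData (R : realType) (n : nat) := NavData {
  nav_cone :> conicDomain R n;
  hmetric : 'rV[R]_n -> 'M[R]_n;
  Wcovec : 'rV[R]_n -> 'rV[R]_n;
  hmetric_reg : forall i j, reg nav_cone (ker_invariant (base nav_cone) Wcovec)
    (fun x _ => hmetric x i j);
  Wcovec_reg : forall i, reg nav_cone (ker_invariant (base nav_cone) Wcovec) (fun
    x _ => Wcovec x 0 i);
  nav_coneP : forall x y, nav_cone x y <-> base nav_cone x /\ 0 < lin (Wcovec x) y;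
  hmetric_sym : forall x, base nav_cone x -> (hmetric x)^T = hmetric x;
  hmetric_posdef : forall x, base nav_cone x -> forall y, y != 0 ->
    0 < bil (hmetric x) y y;
  Wcovec_unit : forall x, base nav_cone x ->
    bil (invmx (hmetric x)) (Wcovec x) (Wcovec x) = 1
}.

(** * Polynomials in the line parameter *)

Section PolynomialArgument.
Context {R : realType}.

Lemma horner_inj (p q : {poly R}) : (forall t, p.[t] = q.[t]) -> p = q.
Proof.
move=> pq; apply/eqP; rewrite -subr_eq0; apply/eqP.
apply: (@roots_geq_poly_eq0 _ _ [seq i%:R | i <- iota 0 (size (p - q))]).
- apply/allP => t _; rewrite rootE !hornerE pq subrr //.
- by rewrite map_inj_uniq ?iota_uniq// => i j /eqP; rewrite eqr_nat => /eqP.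
- by rewrite size_map size_iota.
Qed.

(** The polynomial d = 1 + q t^2 divides (t a + t^2 b)^2.  Modulo d one has
    q t^2 = -1, so that q^2 (t a + t^2 b)^2 is congruent to
    b^2 - q a^2 - 2 q a b t, which has degree less than d and must vanish. *)
Lemma no_double_pole (a b q : R) (p : {poly R}) : 0 < q ->
  (forall t, 3 * q * (t * a + t ^+ 2 * b) ^+ 2 + (1 + q * t ^+ 2) * p.[t] = 0) ->
  a = 0 /\ b = 0.
Proof.
move=> q0 H; have qn0 := lt0r_neq0 q0.
pose l : {poly R} := (b ^+ 2 - q * a ^+ 2)%:P - (2 * q * a * b) *: 'X.
pose d : {poly R} := 1 + q *: 'X^2.
(* The quotient of l by d: the hypothesis expresses q^2 (t a + t^2 b)^2 as
   - (q / 3) p d, and the other terms come from q t^2 = d - 1. *)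
pose p' : {poly R} := - (q / 3) *: p - (q * a ^+ 2)%:P - (2 * q * a * b) *: 'X
   - (b ^+ 2) *: (d - 2%:P).
have ldp : l = d * p'.
  apply: horner_inj => t; rewrite /p' /l /d !(hornerD, hornerN, hornerM, hornerZ,
    hornerC, hornerX, hornerXn).
  have := H t; move: p.[t] => c h.
  apply/eqP; rewrite -subr_eq0 -(mulr0 (q / 3)) -h; apply/eqP; by field.
have sd : size d = 3.
  rewrite /d addrC size_polyDl size_scale// ?size_polyXn// size_poly1//.
have sl : (size l <= 2)%N.
  rewrite (leq_trans (size_polyD _ _))// geq_max size_polyN.
  rewrite (leq_trans (size_polyC_leq1 _))//=.
  by rewrite (leq_trans (size_scale_leq _ _))// size_polyX.
have l0 : l = 0.
  apply/eqP/negPn/negP => l0; move: sl; rewrite ldp size_mul.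
  - rewrite sd (_ : (3 + size p').-1 = (size p').+2)%N//.
    rewrite !ltnS leqn0 size_poly_eq0 => /negPn; apply/negP; rewrite negbK.
    by apply: contra l0 => /eqP p0; rewrite ldp p0 mulr0.
  - by rewrite -size_poly_eq0 sd.
  - by apply: contra l0 => /eqP p0; rewrite ldp p0 mulr0.
have h0 : b ^+ 2 = q * a ^+ 2.
  have := congr1 (fun p : {poly R} => p.[0]) l0; rewrite /l !(hornerD, hornerN,
    hornerM, hornerZ, hornerC, hornerX, hornerXn); lra.
have h1 : a * b = 0.
  have := congr1 (fun p : {poly R} => p.[1]) l0; rewrite /l !(hornerD, hornerN,
    hornerM, hornerZ, hornerC, hornerX, hornerXn) h0 => h.
  by apply: (mulfI qn0); lra.
move/eqP: h1; rewrite mulf_eq0 => /orP[]/eqP h1; split=> //; move: h0; rewrite h1.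
  by rewrite expr0n mulr0 => /eqP; rewrite sqrf_eq0 => /eqP.
rewrite expr0n/= => /esym/eqP; rewrite mulf_eq0 (negbTE qn0)/= sqrf_eq0 => /eqP.
done.
Qed.

End PolynomialArgument.

Section DegreeBounds.
Context {R : realType} {n : nat}.
Notation V := 'rV[R]_n.

(** Functions rather than polynomials: the quantities to be bounded arise by
    evaluating tensors along a line. *)
Definition pdeg (d : nat) (f : R -> R) :=
  exists2 p : {poly R}, (size p <= d.+1)%N & forall t, f t = p.[t].

Lemma pdeg_weak d e f : (d <= e)%N -> pdeg d f -> pdeg e f.
Proof. by move=> de [p sp fp]; exists p => //; apply: leq_trans sp _. Qed.

Lemma pdegD d f g : pdeg d f -> pdeg d g -> pdeg d (fun t => f t + g t).
Proof.
move=> [p sp fp] [q sq gq]; exists (p + q) => [|t]; last by rewrite hornerD fp gq.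
by rewrite (leq_trans (size_polyD _ _))// geq_max sp.
Qed.

Lemma pdegM d e f g : pdeg d f -> pdeg e g -> pdeg (d + e) (fun t => f t * g t).
Proof.
move=> [p sp fp] [q sq gq]; exists (p * q) => [|t]; last by rewrite hornerM fp gq.
rewrite (leq_trans (size_polyMleq _ _))// -ltnS.
case: (size p + size q)%N (leq_add sp sq) => // m.
by rewrite addSn addnS.
Qed.

Lemma pdeg_cst d c : pdeg d (fun=> c).
Proof.
exists c%:P => [|t]; last by rewrite hornerC.
by rewrite (leq_trans (size_polyC_leq1 _)).
Qed.

Lemma pdeg_id : pdeg 1 (fun t => t).
Proof. by exists 'X => [|t]; rewrite ?size_polyX ?hornerX. Qed.

Lemma pdegN d f : pdeg d f -> pdeg d (fun t => - f t).
Proof.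
move=> [p sp fp]; exists (- p) => [|t]; last by rewrite hornerN fp.
by rewrite size_polyN.
Qed.

Lemma pdegB d f g : pdeg d f -> pdeg d g -> pdeg d (fun t => f t - g t).
Proof. by move=> df /pdegN; exact: pdegD. Qed.

Lemma pdeg_sum d I (r : seq I) (f : I -> R -> R) :
  (forall i, pdeg d (f i)) -> pdeg d (fun t => \sum_(i <- r) f i t).
Proof.
move=> df; elim: r => [|i r [p sp fp]].
  by exists 0 => [|t]; rewrite ?size_poly0// big_nil horner0.
have [q sq gq] := df i.
exists (q + p) => [|t]; last by rewrite big_cons hornerD fp gq.
by rewrite (leq_trans (size_polyD _ _))// geq_max sp sq.
Qed.

Definition vdeg d (u : R -> V) := forall i, pdeg d (fun t => u t 0 i).

Lemma vdeg_line (u v : V) : vdeg 1 (fun t => u + t *: v).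
Proof.
move=> i; exists ((u 0 i)%:P + (v 0 i) *: 'X) => [|t]; last first.
  by rewrite !mxE !(hornerD, hornerZ, hornerC, hornerX) mulrC.
rewrite (leq_trans (size_polyD _ _))// geq_max.
rewrite (leq_trans (size_polyC_leq1 _))//=.
by rewrite (leq_trans (size_scale_leq _ _))// size_polyX.
Qed.

Lemma vdeg_cst d (u : V) : vdeg d (fun=> u).
Proof. by move=> i; exact: pdeg_cst. Qed.

Lemma pdeg_bil (A : 'M[R]_n) d e u v : vdeg d u -> vdeg e v ->
  pdeg (d + e) (fun t => bil A (u t) (v t)).
Proof.
move=> du dv.
have [p sp hp] : pdeg (d + e) (fun t => \sum_i \sum_j (A i j * u t 0 i) * v t 0 j).
  apply: pdeg_sum => i; apply: pdeg_sum => j.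
  by apply: pdegM => //; rewrite -[d]add0n; apply: pdegM => //; exact: pdeg_cst.
by exists p => // t; rewrite bilE hp.
Qed.

Lemma pdeg_lin (p : V) d u : vdeg d u -> pdeg d (fun t => lin p (u t)).
Proof.
move=> du.
have [q sq hq] : pdeg d (fun t => \sum_i p 0 i * u t 0 i).
  by apply: pdeg_sum => i; rewrite -[d]add0n; apply: pdegM => //; exact: pdeg_cst.
by exists q => // t; rewrite linE hq.
Qed.

Lemma no_quartic_term (f : R -> R) (c q : R) : pdeg 3 f -> q != 0 ->
  (forall t, f t = c * (1 - q ^+ 2 * t ^+ 4)) -> c = 0.
Proof.
move=> [p sp fp] q0 h.
have E : p = c%:P - (c * q ^+ 2) *: 'X^4.
  apply: horner_inj => t; rewrite -fp h.
  by rewrite !(hornerD, hornerN, hornerZ, hornerC, hornerXn); ring.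
have : p`_4 = 0 by rewrite nth_default.
rewrite E coefB coefC coefZ coefXn eqxx/= mulr1 sub0r => /eqP.
by rewrite oppr_eq0 mulf_eq0 expf_eq0 (negbTE q0) andbF orbF => /eqP.
Qed.

End DegreeBounds.

(** * The Levi-Civita connection of h and the covariant derivative of W *)

Section Nav.
Context {R : realType} {n : nat} (N : navData R n).
Notation V := 'rV[R]_n.
Notation J := (ker_invariant (base N) (Wcovec N)).
Implicit Types (x y z u v : V) (s : bool) (k : 'I_n).

Definition hprod x := bil (hmetric N x).
Definition Wform x := lin (Wcovec N x).
(** Index raising; on row vectors it is multiplication by the inverse metric. *)
Definition raise x (p : V) : V := p *m invmx (hmetric N x).
Definition Wfield x : V := raise x (Wcovec N x).
(** The y-argument of [dd] is a dummy here, since the entries depend on x only. *)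
Definition dh_mx x z : 'M[R]_n :=
  \matrix_(k, l) dd true z (fun x1 _ => hmetric N x1 k l) x 0.
Definition dhprod x z := bil (dh_mx x z).
Definition dWform x z : V -> R :=
  lin (\row_k dd true z (fun x1 _ => Wcovec N x1 0 k) x 0).

Lemma hprodC x u v : base N x -> hprod x u v = hprod x v u.
Proof. by move=> Ux; apply/bilC/hmetric_sym. Qed.

Lemma hprod_lin x : (forall u1 u2 v, hprod x (u1 + u2) v =
  hprod x u1 v + hprod x u2 v) *
  (forall u v1 v2, hprod x u (v1 + v2) = hprod x u v1 + hprod x u v2) *
  (forall c u v, hprod x (c *: u) v = c * hprod x u v) *
  (forall c u v, hprod x u (c *: v) = c * hprod x u v) *
  (forall u v, hprod x (- u) v = - hprod x u v) *
  (forall u v, hprod x u (- v) = - hprod x u v) *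
  (forall v, hprod x 0 v = 0) * (forall u, hprod x u 0 = 0).
Proof.
by do ![split]; move=> *; rewrite /hprod ?bilDl ?bilDr ?bilZl ?bilZr ?bilNl
  ?bilNr ?bil0l ?bil0r.
Qed.

Lemma dhprod_lin x z : (forall u1 u2 v, dhprod x z (u1 + u2) v =
  dhprod x z u1 v + dhprod x z u2 v) *
  (forall u v1 v2, dhprod x z u (v1 + v2) = dhprod x z u v1 + dhprod x z u v2) *
  (forall c u v, dhprod x z (c *: u) v = c * dhprod x z u v) *
  (forall c u v, dhprod x z u (c *: v) = c * dhprod x z u v) *
  (forall u v, dhprod x z (- u) v = - dhprod x z u v) *
  (forall u v, dhprod x z u (- v) = - dhprod x z u v) *
  (forall v, dhprod x z 0 v = 0) * (forall u, dhprod x z u 0 = 0).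
Proof.
by do ![split]; move=> *; rewrite /dhprod ?bilDl ?bilDr ?bilZl ?bilZr ?bilNl
  ?bilNr ?bil0l ?bil0r.
Qed.

Lemma Wform_lin x : (forall u v, Wform x (u + v) = Wform x u + Wform x v) *
  (forall c v, Wform x (c *: v) = c * Wform x v) *
  (forall v, Wform x (- v) = - Wform x v) * (Wform x 0 = 0).
Proof. by do ![split]; move=> *; rewrite /Wform ?lin_rules. Qed.

Lemma dWform_lin x z : (forall u v, dWform x z (u + v) =
  dWform x z u + dWform x z v) *
  (forall c v, dWform x z (c *: v) = c * dWform x z v) *
  (forall v, dWform x z (- v) = - dWform x z v) * (dWform x z 0 = 0).
Proof. by do ![split]; move=> *; rewrite /dWform ?lin_rules. Qed.

Lemma hmetric_unitmx x : base N x -> hmetric N x \in unitmx.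
Proof. by move=> Ux; apply: posdef_unit => y; exact: hmetric_posdef. Qed.

Lemma hprod_raise x p v : base N x -> hprod x (raise x p) v = lin p v.
Proof. by move=> Ux; rewrite /hprod /bil /raise mulmxKV// hmetric_unitmx. Qed.

Lemma hprod_Wfield x v : base N x -> hprod x (Wfield x) v = Wform x v.
Proof. exact: hprod_raise. Qed.

Lemma hprod_Wfieldr x v : base N x -> hprod x v (Wfield x) = Wform x v.
Proof. by move=> Ux; rewrite hprodC// hprod_Wfield. Qed.

Lemma Wform_Wfield x : base N x -> Wform x (Wfield x) = 1.
Proof.
move=> Ux; rewrite -(Wcovec_unit Ux) /Wform/Wfield/raise/lin/bil.
by rewrite trmx_mul trmx_inv hmetric_sym// mulmxA.
Qed.

Lemma hprod_inj x u v : base N x -> (forall z, hprod x u z = hprod x v z) -> u = v.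
Proof.
move=> Ux uv; have /lin_inj e : forall z, lin (u *m hmetric N x) z =
  lin (v *m hmetric N x) z.
  exact: uv.
by rewrite -[u](mulmxK (hmetric_unitmx Ux)) e mulmxK// hmetric_unitmx.
Qed.

Lemma dd_xonly_y z (c : V -> R) x y :
  dd true z (fun x _ => c x) x y = dd true z (fun x _ => c x) x 0.
Proof. by rewrite !ddE. Qed.

(** Vector-valued expressions, regular componentwise with respect to the
    inversions that create no pole on the lines W + t v. *)
Definition regv (u : V -> V -> V) := forall k, reg N J (fun x y => u x y 0 k).
Definition ddv s z (u : V -> V -> V) x y : V :=
  \row_k dd s z (fun x y => u x y 0 k) x y.

Lemma regv_cst v : regv (fun _ _ => v).
Proof. by move=> k; exact: reg_cst. Qed.
Lemma regv_y : regv (fun _ y => y).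
Proof. by move=> k; exact: reg_coord. Qed.

Lemma ddv_cst s z v x y : ddv s z (fun _ _ => v) x y = 0.
Proof. by apply/rowP => k; rewrite !mxE dd_cst. Qed.
Lemma ddv_y s z x y : ddv s z (fun _ y => y) x y = if s then 0 else z.
Proof. by apply/rowP => k; rewrite !mxE dd_coord; case: s; rewrite ?mxE. Qed.

Lemma dd_bil s z (A : V -> 'M[R]_n) (u v : V -> V -> V) x y :
  (forall i j, reg N J (fun x _ => A x i j)) ->
  regv u -> regv v -> N x y ->
  dd s z (fun x y => bil (A x) (u x y) (v x y)) x y =
  (if s then bil (\matrix_(k, l) dd true z (fun x1 _ => A x1 k l) x 0)
       (u x y) (v x y) else 0) +
  bil (A x) (ddv s z u x y) (v x y) + bil (A x) (u x y) (ddv s z v x y).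
Proof.
move=> rA ru rv Nxy.
transitivity (dd s z (fun x y =>
  \sum_k \sum_l A x k l * u x y 0 k * v x y 0 l) x y).
  by apply: dd_eq Nxy => x1 y1 _; rewrite bilE.
have r1 k l : reg N J (fun x y => A x k l * u x y 0 k).
  by apply: regM.
have r2 k l : reg N J (fun x y => A x k l * u x y 0 k * v x y 0 l).
  by apply: regM.
rewrite (dd_sum (J := J) _ Nxy); last by move=> k; exact: reg_sum.
have -> : (if s then bil (\matrix_(k, l) dd true z (fun x1 _ => A x1 k l) x 0)
       (u x y) (v x y) else 0) =
  bil (\matrix_(k, l) dd s z (fun x1 _ => A x1 k l) x y) (u x y) (v x y).
  case: s.
    by congr bil; apply/matrixP => k l; rewrite !mxE [RHS]dd_xonly_y.
  rewrite [RHS]bilE big1// => k _; rewrite big1// => l _.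
  by rewrite mxE (dd_xonly z) !mul0r.
rewrite !bilE -!big_split/=; apply: eq_bigr => k _.
rewrite (dd_sum (J := J) _ Nxy)// -!big_split/=; apply: eq_bigr => l _.
rewrite (ddM (r1 k l) (rv l) Nxy) (ddM (rA k l) (ru k) Nxy) !mxE.
ring.
Qed.

Lemma dd_lin s z (p : V -> V) (v : V -> V -> V) x y :
  (forall i, reg N J (fun x _ => p x 0 i)) -> regv v -> N x y ->
  dd s z (fun x y => lin (p x) (v x y)) x y =
  (if s then lin (\row_k dd true z (fun x1 _ => p x1 0 k) x 0)
       (v x y) else 0) + lin (p x) (ddv s z v x y).
Proof.
move=> rp rv Nxy.
transitivity (dd s z (fun x y => \sum_k p x 0 k * v x y 0 k) x y).
  by apply: dd_eq Nxy => x1 y1 _; rewrite linE.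
rewrite (dd_sum (J := J) _ Nxy); last by move=> k; exact: regM.
have -> : (if s then lin (\row_k dd true z (fun x1 _ => p x1 0 k) x 0)
       (v x y) else 0) =
  lin (\row_k dd s z (fun x1 _ => p x1 0 k) x y) (v x y).
  case: s.
    by congr lin; apply/rowP => k; rewrite !mxE [RHS]dd_xonly_y.
  rewrite [RHS]linE big1// => k _.
  by rewrite mxE (dd_xonly z) !mul0r.
rewrite !linE -!big_split/=; apply: eq_bigr => k _.
by rewrite (ddM (rp k) (rv k) Nxy) !mxE.
Qed.

Lemma reg_bil (A : V -> 'M[R]_n) (u v : V -> V -> V) :
  (forall i j, reg N J (fun x _ => A x i j)) -> regv u -> regv v ->
  reg N J (fun x y => bil (A x) (u x y) (v x y)).
Proof.
move=> rA ru rv; apply: (@reg_eq _ _ _ _ (fun x y =>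
  \sum_k \sum_l A x k l * u x y 0 k * v x y 0 l)); last first.
  by move=> x y _; rewrite bilE.
apply: reg_sum => k _; apply: reg_sum => l _; apply: regM => //; exact: regM.
Qed.

Lemma reg_lin (p : V -> V) (v : V -> V -> V) :
  (forall i, reg N J (fun x _ => p x 0 i)) -> regv v ->
  reg N J (fun x y => lin (p x) (v x y)).
Proof.
move=> rp rv; apply: (@reg_eq _ _ _ _ (fun x y =>
  \sum_k p x 0 k * v x y 0 k)); last first.
  by move=> x y _; rewrite linE.
by apply: reg_sum => k _; apply: regM.
Qed.

Lemma reg_hprod (u v : V -> V -> V) : regv u -> regv v -> reg N J (fun x y =>
  hprod x (u x y) (v x y)).
Proof. exact/reg_bil/hmetric_reg. Qed.
Lemma reg_Wform (v : V -> V -> V) : regv v -> reg N J (fun x y => Wform x (v x y)).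
Proof. exact/reg_lin/Wcovec_reg. Qed.

Lemma dd_hprod s z (u v : V -> V -> V) x y : regv u -> regv v -> N x y ->
  dd s z (fun x y => hprod x (u x y) (v x y)) x y =
  (if s then dhprod x z (u x y) (v x y) else 0) +
  hprod x (ddv s z u x y) (v x y) + hprod x (u x y) (ddv s z v x y).
Proof. exact/dd_bil/hmetric_reg. Qed.

Lemma dd_Wform s z (v : V -> V -> V) x y : regv v -> N x y ->
  dd s z (fun x y => Wform x (v x y)) x y =
  (if s then dWform x z (v x y) else 0) + Wform x (ddv s z v x y).
Proof. exact/dd_lin/Wcovec_reg. Qed.

Lemma nav_base x y : N x y -> base N x. Proof. exact: cone_base. Qed.

Lemma reg_invmx_hmetric i j : reg N J (fun x _ => invmx (hmetric N x) i j).
Proof.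
by apply: reg_invmx => [||x y /nav_base/hmetric_unitmx//];
  [exact: hmetric_reg|move=> x Ux].
Qed.

Lemma regv_raise (p : V -> V -> V) : regv p -> regv (fun x y => raise x (p x y)).
Proof.
move=> rp k; apply: (@reg_eq _ _ _ _ (fun x y =>
  \sum_l p x y 0 l * invmx (hmetric N x) l k)).
  by apply: reg_sum => l _; apply: regM => //; exact: reg_invmx_hmetric.
by move=> x y _; rewrite mxE.
Qed.

Lemma regv_Wfield : regv (fun x _ => Wfield x).
Proof. by apply: (regv_raise (p := fun x _ => Wcovec N x)) => k;
  exact: Wcovec_reg. Qed.

Lemma dh_mx_sym x z : base N x -> (exists y, N x y) -> (dh_mx x z)^T = dh_mx x z.
Proof.
move=> Ux [y Nxy]; apply/matrixP => k l; rewrite !mxE.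
rewrite -(dd_xonly_y _ _ x y) -[RHS](dd_xonly_y _ _ x y).
apply: dd_eq Nxy => x1 y1 /nav_base /hmetric_sym e.
by rewrite -[in LHS]e mxE.
Qed.

Lemma Wfield_cone x : base N x -> N x (Wfield x).
Proof. by move=> Ux; apply/nav_coneP; split => //;
  rewrite -/(Wform _ _) Wform_Wfield. Qed.

Lemma dhprodC x z u v : base N x -> dhprod x z u v = dhprod x z v u.
Proof. move=> Ux; apply/bilC/dh_mx_sym => //; exists (Wfield x);
  exact: Wfield_cone. Qed.

Lemma dh_mxD x u v : dh_mx x (u + v) = dh_mx x u + dh_mx x v.
Proof. by apply/matrixP => k l; rewrite !mxE dd_vD. Qed.
Lemma dh_mxZ x c v : dh_mx x (c *: v) = c *: dh_mx x v.
Proof. by apply/matrixP => k l; rewrite !mxE dd_vZ. Qed.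

Lemma dhprodD x u v y z : dhprod x (u + v) y z = dhprod x u y z + dhprod x v y z.
Proof. by rewrite /dhprod dh_mxD /bil mulmxDr mulmxDl mxE. Qed.
Lemma dhprodZ x c v y z : dhprod x (c *: v) y z = c * dhprod x v y z.
Proof. by rewrite /dhprod dh_mxZ /bil -scalemxAr -scalemxAl mxE. Qed.
Lemma dWformD x u v y : dWform x (u + v) y = dWform x u y + dWform x v y.
Proof.
rewrite /dWform -linDl; congr lin; by apply/rowP => k; rewrite !mxE dd_vD.
Qed.
Lemma dWformZ x c v y : dWform x (c *: v) y = c * dWform x v y.
Proof.
rewrite /dWform -linZl; congr lin; by apply/rowP => k; rewrite !mxE dd_vZ.
Qed.

Definition Gamma x u v : V :=
  \row_i \sum_j \sum_k christoffel (hmetric N) i j k x * u 0 j * v 0 k.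

Lemma dhprod_delta x k u v : dhprod x (delta_mx 0 k) u v =
  \sum_i \sum_j pd k (fun x1 => hmetric N x1 i j) x * u 0 i * v 0 j.
Proof.
rewrite /dhprod bilE; apply: eq_bigr => i _; apply: eq_bigr => j _.
by rewrite mxE dd_delta.
Qed.

Lemma invmx_hmetric_sym x : base N x -> (invmx (hmetric N x))^T = invmx (hmetric N x).
Proof. by move=> Ux; rewrite trmx_inv hmetric_sym. Qed.

Lemma raise_delta x (p : V) i : base N x ->
  raise x p 0 i = \sum_l invmx (hmetric N x) i l * p 0 l.
Proof.
move=> Ux; rewrite mxE; apply: eq_bigr => l _.
by rewrite mulrC -[in LHS](invmx_hmetric_sym Ux) mxE.
Qed.

Lemma dhprod_delta_l x z l v : dhprod x z (delta_mx 0 l) v =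
  \sum_k dh_mx x z l k * v 0 k.
Proof.
rewrite /dhprod /bil -rowE -/(lin _ _) linE; apply: eq_bigr => k _.
by congr (_ * _); rewrite mxE.
Qed.

Lemma GammaE x u v : base N x ->
  Gamma x u v = raise x (\row_l (2^-1 * (dhprod x u (delta_mx 0 l) v +
    dhprod x v (delta_mx 0 l) u - dhprod x (delta_mx 0 l) u v))).
Proof.
move=> Ux; apply/rowP => i; rewrite raise_delta// mxE /christoffel.
under eq_bigr => j _ do under eq_bigr => k _ do
  rewrite mulr_sumr !mulr_suml.
under eq_bigr => j _ do rewrite exchange_big.
rewrite exchange_big /=; apply: eq_bigr => l _.
rewrite mxE !dhprod_delta_l dhprod_delta.
have -> : \sum_k dh_mx x u l k * v 0 k =
    \sum_j \sum_k pd j (fun x1 => hmetric N x1 l k) x * u 0 j * v 0 k.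
  rewrite exchange_big; apply: eq_bigr => k _; rewrite mxE ddE mulr_suml.
  by apply: eq_bigr => j _; rewrite [_ * u 0 j]mulrC.
have -> : \sum_k dh_mx x v l k * u 0 k =
    \sum_j \sum_k pd k (fun x1 => hmetric N x1 l j) x * u 0 j * v 0 k.
  apply: eq_bigr => j _; rewrite mxE ddE mulr_suml.
  by apply: eq_bigr => k _; rewrite [v 0 k * _]mulrC mulrAC.
rewrite -big_split -sumrB/= !mulr_sumr; apply: eq_bigr => j _.
rewrite -big_split -sumrB/= !mulr_sumr; apply: eq_bigr => k _.
ring.
Qed.

Lemma dhprod_sum x (u v z : V) : dhprod x z u v =
  \sum_l dhprod x (delta_mx 0 l) u v * z 0 l.
Proof.
have -> : dhprod x z u v = dhprod x (\sum_l z 0 l *: delta_mx 0 l) u v.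
  by rewrite -row_sum_delta.
elim/big_ind2 : _ => [|_ a _ b <- <-|i _].
- by rewrite -(scale0r 0) dhprodZ mul0r.
- by rewrite dhprodD.
- by rewrite dhprodZ mulrC.
Qed.

(** Koszul's formula.  As h is nondegenerate it characterizes the Christoffel
    form, and it lets the rest of the computation avoid indices. *)
Lemma hprod_Gamma x u v z : base N x ->
  hprod x (Gamma x u v) z = 2^-1 * (dhprod x u v z + dhprod x v u z - dhprod x z u v).
Proof.
move=> Ux; rewrite GammaE// hprod_raise// linE (dhprod_sum x u v z).
have E w v' : dhprod x w v' z = \sum_l dhprod x w v' (delta_mx 0 l) * z 0 l.
  rewrite /dhprod -lin_mul linE; apply: eq_bigr => l _; congr (_ * _).
  by rewrite /bil trmx_delta -colE [RHS]mxE.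
rewrite !E -big_split -sumrB/= mulr_sumr; apply: eq_bigr => l _.
by rewrite mxE (dhprodC u (delta_mx 0 l) v Ux) (dhprodC v (delta_mx 0 l) u Ux); ring.
Qed.

Lemma GammaC x u v : base N x -> Gamma x u v = Gamma x v u.
Proof.
move=> Ux; apply: (hprod_inj Ux) => z; rewrite !hprod_Gamma// (dhprodC z u v Ux);
  ring.
Qed.

Lemma Gamma_lin x : base N x -> (forall u1 u2 v, Gamma x (u1 + u2) v =
  Gamma x u1 v + Gamma x u2 v) *
  (forall u v1 v2, Gamma x u (v1 + v2) = Gamma x u v1 + Gamma x u v2) *
  (forall c u v, Gamma x (c *: u) v = c *: Gamma x u v) *
  (forall c u v, Gamma x u (c *: v) = c *: Gamma x u v).
Proof.
by move=> Ux; do ![split]; move=> *; apply: (hprod_inj Ux) => z;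
  rewrite ?hprod_lin !hprod_Gamma// ?(dhprodD, dhprodZ) !dhprod_lin; ring.
Qed.

(** This is v^l z^j W_{l||j}: the first argument fills the slot of the 1-form, the
    second is the direction of differentiation. *)
Definition covW x v z : R := dWform x z v - Wform x (Gamma x v z).

Lemma covW_lin x : base N x -> (forall u1 u2 v, covW x (u1 + u2) v =
  covW x u1 v + covW x u2 v) *
  (forall u v1 v2, covW x u (v1 + v2) = covW x u v1 + covW x u v2) *
  (forall c u v, covW x (c *: u) v = c * covW x u v) *
  (forall c u v, covW x u (c *: v) = c * covW x u v).
Proof.
by move=> Ux; do ![split]; move=> *;
  rewrite /covW ?dWformD ?dWformZ !(Gamma_lin Ux) !(Wform_lin, dWform_lin); ring.
Qed.

(** Differentiate h(W,v) = w(v) with v constant. *)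
Lemma ddv_Wfield x z v : base N x ->
  hprod x (ddv true z (fun x1 _ => Wfield x1) x (Wfield x)) v =
    dWform x z v - dhprod x z (Wfield x) v.
Proof.
move=> Ux; have Nx := Wfield_cone Ux.
have : dd true z (fun x1 _ => hprod x1 (Wfield x1) v) x (Wfield x) =
       dd true z (fun x1 _ => Wform x1 v) x (Wfield x).
  by apply: (dd_eq _ Nx) => x1 y1 /nav_base Ux1; rewrite hprod_Wfield.
rewrite (dd_hprod (u := fun x1 _ => Wfield x1) (v := fun _ _ => v) true z _ _ Nx);
  [|exact: regv_Wfield|exact: regv_cst].
rewrite (dd_Wform (v := fun _ _ => v) true z _ Nx); last exact: regv_cst.
rewrite !ddv_cst !hprod_lin !Wform_lin !addr0 => <-; ring.
Qed.

Lemma dWform_Wfield x z : base N x -> dWform x z (Wfield x) =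
  2^-1 * dhprod x z (Wfield x) (Wfield x).
Proof.
move=> Ux; have Nx := Wfield_cone Ux.
have : dd true z (fun x1 _ => hprod x1 (Wfield x1) (Wfield x1)) x (Wfield x) = 0.
  rewrite -[RHS](dd_cst true z 1 x (Wfield x)).
  by apply: (dd_eq _ Nx) => x1 y1 /nav_base Ux1; rewrite hprod_Wfield// Wform_Wfield.
rewrite (dd_hprod (u := fun x1 _ => Wfield x1) (v := fun x1 _ =>
  Wfield x1) true z _ _ Nx);
  [|exact: regv_Wfield|exact: regv_Wfield].
rewrite (hprodC (Wfield x) _ Ux) ddv_Wfield// => h; lra.
Qed.

(** W has constant length. *)
Lemma covW_Wfield x z : base N x -> covW x (Wfield x) z = 0.
Proof.
move=> Ux; rewrite /covW dWform_Wfield// -(hprod_Wfieldr _ Ux) hprod_Gamma//.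
rewrite (dhprodC (Wfield x) z (Wfield x) Ux); ring.
Qed.

(** Lowering an index commutes with covariant differentiation. *)
Lemma covW_ddv_Wfield x z v : base N x ->
  hprod x (ddv true z (fun x1 _ =>
    Wfield x1) x (Wfield x) + Gamma x z (Wfield x)) v = covW x v z.
Proof.
move=> Ux; rewrite hprod_lin ddv_Wfield// hprod_Gamma// /covW -(hprod_Wfieldr _
  Ux) hprod_Gamma//.
by rewrite (dhprodC z v (Wfield x) Ux) (dhprodC (Wfield x) v z Ux); field.
Qed.

Lemma cov_derivativeE x j v : base N x ->
  lin (\row_k cov_derivative (hmetric N) Wfield k j x *m hmetric N x) v =
    covW x v (delta_mx 0 j).
Proof.
move=> Ux.
have -> : \row_k cov_derivative (hmetric N) Wfield k j x =
    ddv true (delta_mx 0 j) (fun x1 _ => Wfield x1) x (Wfield x) +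
    Gamma x (delta_mx 0 j) (Wfield x).
  apply/rowP => k; rewrite !mxE /cov_derivative dd_delta; congr (_ + _).
  rewrite [RHS](bigD1 j)//= [X in _ = _ + X]big1 ?addr0.
    by apply: eq_bigr => l _; rewrite !mxE !eqxx mulr1.
  move=> l /negbTE lj; rewrite big1// => m _.
  by rewrite !mxE lj andbF mulr0 mul0r.
by rewrite lin_mul -/(hprod x _ _) covW_ddv_Wfield.
Qed.

(** * The Kropina metric in navigation form and its derivatives *)

(** F(y) = 1 means H = 2 w, that is, |y - W| = 1. *)
Definition Fnav x y : R := hprod x y y / (2 * Wform x y).

Lemma Wform_gt0 x y : N x y -> 0 < Wform x y.
Proof. by move=> /nav_coneP[]. Qed.
Lemma Wform_neq0 x y : N x y -> Wform x y != 0.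
Proof. by move=> /Wform_gt0; rewrite lt0r => /andP[]. Qed.

Lemma reg_Wform_y : reg N J (fun x y => Wform x y).
Proof. exact/reg_Wform/regv_y. Qed.
Lemma reg_hprod_yy : reg N J (fun x y => hprod x y y).
Proof. by apply: reg_hprod; exact: regv_y. Qed.

Lemma ker_invariant_Wform : J (fun x y => Wform x y).
Proof. by move=> x _ y v omv; rewrite /Wform linD omv addr0. Qed.

Lemma reg_WformV : reg N J (fun x y => (Wform x y)^-1).
Proof. by apply: regV => [||x y /Wform_neq0//];
  [exact: reg_Wform_y|exact: ker_invariant_Wform]. Qed.

Lemma reg_Fnav : reg N J Fnav.
Proof.
apply: reg_eq (regM (regM (reg_cst _ 2^-1) reg_hprod_yy) reg_WformV) _ => x y Nxy.
by rewrite /Fnav invfM mulrCA mulrA.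
Qed.

Lemma FnavE x y : N x y -> 2 * Wform x y * Fnav x y = hprod x y y.
Proof. by move=> Nxy; rewrite /Fnav mulrC divfK// mulf_neq0 ?Wform_neq0. Qed.

Lemma Fnav_gt0 x y : N x y -> 0 < Fnav x y.
Proof.
move=> Nxy; rewrite divr_gt0//; last by rewrite mulr_gt0// Wform_gt0.
apply: hmetric_posdef; first exact: cone_base Nxy.
apply: contra_neq (Wform_neq0 Nxy) => ->; exact: lin0.
Qed.

Lemma dy_Wform z x y : N x y -> dd false z (fun x y => Wform x y) x y = Wform x z.
Proof. by move=> Nxy; rewrite (dd_Wform _ _ (@regv_y) Nxy) ddv_y add0r. Qed.
Lemma dx_Wform z x y : N x y -> dd true z (fun x y => Wform x y) x y = dWform x z y.
Proof.
move=> Nxy; rewrite (dd_Wform _ _ (@regv_y) Nxy) ddv_y.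
by rewrite [Wform x _](Wform_lin x) addr0.
Qed.
Lemma dy_hprod_yy z x y : N x y -> dd false z (fun x y => hprod x y y) x y =
  2 * hprod x y z.
Proof.
move=> Nxy; rewrite (dd_hprod _ _ (@regv_y) (@regv_y) Nxy) ddv_y.
rewrite (hprodC _ _ (nav_base Nxy)); ring.
Qed.
Lemma dx_hprod_yy z x y : N x y -> dd true z (fun x y => hprod x y y) x y =
  dhprod x z y y.
Proof.
move=> Nxy; rewrite (dd_hprod _ _ (@regv_y) (@regv_y) Nxy) ddv_y.
by rewrite !hprod_lin !addr0.
Qed.
Lemma dy_hprod z v x y : N x y -> dd false z (fun x y => hprod x y v) x y =
  hprod x z v.
Proof.
move=> Nxy; rewrite (dd_hprod _ _ (@regv_y) (@regv_cst v) Nxy).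
by rewrite ddv_y ddv_cst !hprod_lin add0r addr0.
Qed.
Lemma dx_hprod z v x y : N x y -> dd true z (fun x y => hprod x y v) x y =
  dhprod x z y v.
Proof.
move=> Nxy; rewrite (dd_hprod _ _ (@regv_y) (@regv_cst v) Nxy).
by rewrite ddv_y ddv_cst !hprod_lin !addr0.
Qed.

(** All derivatives of F are obtained by differentiating 2 w F = H, which avoids
    quotients. *)
Lemma dd_Fnav s z x y : N x y ->
  2 * (dd s z (fun x y => Wform x y) x y * Fnav x y + Wform x y * dd s z Fnav x y) =
  dd s z (fun x y => hprod x y y) x y.
Proof.
move=> Nxy; rewrite -(ddM reg_Wform_y reg_Fnav Nxy) -(ddZ (regM reg_Wform_y
  reg_Fnav) Nxy).
by apply: (dd_eq _ Nxy) => x1 y1 N1; rewrite -FnavE// mulrA.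
Qed.

Lemma dy_Fnav z x y : N x y ->
  Wform x y * dd false z Fnav x y = hprod x y z - Fnav x y * Wform x z.
Proof. move=> Nxy; have := dd_Fnav false z Nxy; rewrite dy_Wform// dy_hprod_yy//;
  lra. Qed.

Lemma dx_Fnav z x y : N x y ->
  2 * Wform x y * dd true z Fnav x y = dhprod x z y y - 2 * Fnav x y * dWform x z y.
Proof. move=> Nxy; have := dd_Fnav true z Nxy; rewrite dx_Wform// dx_hprod_yy//;
  lra. Qed.

Lemma ddy_Fnav s z v x y : N x y ->
  dd s z (fun x y => Wform x y) x y * dd false v Fnav x y +
    Wform x y * dd s z (dd false v Fnav) x y =
  dd s z (fun x y => hprod x y v) x y - (dd s z Fnav x y * Wform x v +
    Fnav x y * (if s then dWform x z v else 0)).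
Proof.
move=> Nxy; rewrite -(ddM reg_Wform_y (reg_dd _ _ reg_Fnav) Nxy).
have ro := @reg_Wform (fun _ _ => v) (regv_cst v).
have rb : reg N J (fun x y => hprod x y v) by apply: reg_hprod;
  [exact: regv_y|exact: regv_cst].
transitivity (dd s z (fun x y => hprod x y v + (-1) * (Fnav x y * Wform x v)) x y).
  by apply: (dd_eq _ Nxy) => x1 y1 N1; rewrite dy_Fnav// mulN1r.
have rm := regM reg_Fnav ro.
rewrite (ddD rb (regM (reg_cst _ (-1)) rm) Nxy) (ddZ rm Nxy) (ddM reg_Fnav ro Nxy).
rewrite (dd_Wform s z (v := fun _ _ => v) (regv_cst v) Nxy) ddv_cst Wform_lin addr0.
by rewrite mulN1r.
Qed.

Lemma dyy_Fnav z v x y : N x y ->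
  Wform x y * dd false z (dd false v Fnav) x y =
  hprod x z v - dd false z Fnav x y * Wform x v - Wform x z * dd false v Fnav x y.
Proof. by move=> Nxy; have := ddy_Fnav false z v Nxy;
  rewrite dy_Wform// dy_hprod//; lra. Qed.

Lemma dxy_Fnav z v x y : N x y ->
  Wform x y * dd true z (dd false v Fnav) x y =
  dhprod x z y v - dd true z Fnav x y * Wform x v - Fnav x y * dWform x z v
  - dWform x z y * dd false v Fnav x y.
Proof. by move=> Nxy; have := ddy_Fnav true z v Nxy;
  rewrite dx_Wform// dx_hprod//; lra. Qed.

(** * The geodesic spray *)

Lemma reg_christoffel i j k : reg N J (fun x _ => christoffel (hmetric N) i j k x).
Proof.
apply: regM; first exact: reg_cst.
apply: reg_sum => l _; apply: regM; first exact: reg_invmx_hmetric.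
have rp a b c : reg N J (fun x _ => pd a (fun x1 => hmetric N x1 b c) x).
  exact: (reg_partial true a (hmetric_reg N b c)).
by apply: regB; first apply: regD; exact: rp.
Qed.

Lemma regv_Gamma (u v : V -> V -> V) : regv u -> regv v ->
  regv (fun x y => Gamma x (u x y) (v x y)).
Proof.
move=> ru rv i; apply: (@reg_eq _ _ _ _ (fun x y =>
  \sum_j \sum_k christoffel (hmetric N) i j k x * u x y 0 j * v x y 0 k)).
  apply: reg_sum => j _; apply: reg_sum => k _; apply: regM => //.
  by apply: regM => //; exact: reg_christoffel.
by move=> x y _; rewrite mxE.
Qed.

Lemma reg_dWform (u v : V -> V -> V) : regv u -> regv v ->
  reg N J (fun x y => dWform x (u x y) (v x y)).
Proof.
move=> ru rv; apply: (@reg_eq _ _ _ _ (fun x y =>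
  \sum_k dd true (u x y) (fun x1 _ => Wcovec N x1 0 k) x y * v x y 0 k)).
  apply: reg_sum => k _; apply: regM => //.
  by apply: reg_ddv => //; exact: Wcovec_reg.
by move=> x y _; rewrite /dWform linE; apply: eq_bigr => k _;
  rewrite mxE [in LHS]dd_xonly_y.
Qed.

Lemma reg_covW (u v : V -> V -> V) : regv u -> regv v ->
  reg N J (fun x y => covW x (u x y) (v x y)).
Proof.
move=> ru rv; apply: regB; first exact: reg_dWform.
by apply: reg_Wform; exact: regv_Gamma.
Qed.

(** Dual to z |-> D(z,y) - D(y,z). *)
Definition curlW x y : V :=
  raise x (\row_k (covW x (delta_mx 0 k) y - covW x y (delta_mx 0 k))).
(** The next three definitions solve the equations [dy_Fnav_navspray] and
    [dyy_Fnav_navspray] for the spray.  By the second one, the difference between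
    2 G and the spray of h is a combination of y - F W and [curlW]; pairing with
    W and using the first one determines the coefficient of y - F W. *)
Definition radial x y : R := covW x y (Wfield x) - covW x y y / Fnav x y.
Definition spray_shift x y : V :=
  radial x y *: (y - Fnav x y *: Wfield x) - Fnav x y *: curlW x y.
Definition navspray x y : V := 2^-1 *: (Gamma x y y + spray_shift x y).

Lemma hprod_curlW x y z : base N x -> hprod x (curlW x y) z = covW x z y - covW x y z.
Proof.
move=> Ux; rewrite hprod_raise// linE.
rewrite (basis_expansion (f := fun z => covW x z y)); [|by move=> *;
  rewrite covW_lin..].
rewrite (basis_expansion (f := fun z => covW x y z)); [|by move=> *;
  rewrite covW_lin..].
by rewrite -sumrB; apply: eq_bigr => k _; rewrite mxE mulrBl.
Qed.

Lemma radialF x y : N x y -> radial x y * Fnav x y =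
  covW x y (Wfield x) * Fnav x y - covW x y y.
Proof.
by move=> Nxy; rewrite /radial mulrBl divfK// gt_eqF// Fnav_gt0.
Qed.

Lemma Wform_spray_shift x y : N x y ->
  Wform x (spray_shift x y) = radial x y * (Wform x y - Fnav x y) + Fnav x y *
    covW x y (Wfield x).
Proof.
move=> Nxy; have Ux := nav_base Nxy.
rewrite /spray_shift !Wform_lin Wform_Wfield// -(hprod_Wfield (curlW x y) Ux)
  (hprodC _ (curlW x y) Ux) hprod_curlW//.
rewrite covW_Wfield//; ring.
Qed.

Lemma hprod_spray_shift x y z : N x y ->
  hprod x (spray_shift x y) z = radial x y * (hprod x y z - Fnav x y * Wform x z)
    - Fnav x y * (covW x z y - covW x y z).
Proof.
by move=> Nxy; have Ux := nav_base Nxy;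
  rewrite /spray_shift !hprod_lin hprod_Wfield// hprod_curlW.
Qed.

Lemma hprod_navspray x y z : base N x ->
  hprod x (navspray x y) z = 2^-1 * (hprod x (Gamma x y y) z + hprod x
    (spray_shift x y) z).
Proof. by move=> Ux; rewrite /navspray; move: (spray_shift x y) => q;
  rewrite !hprod_lin. Qed.

Lemma Wform_navspray x y : N x y -> Wform x (navspray x y) =
  2^-1 * (dWform x y y - covW x y y +
  (radial x y * (Wform x y - Fnav x y) + Fnav x y * covW x y (Wfield x))).
Proof.
move=> Nxy; rewrite -Wform_spray_shift// /navspray; move: (spray_shift x y) => q.
by rewrite !Wform_lin /covW; ring.
Qed.

(** F is constant along its geodesics. *)
Lemma dy_Fnav_navspray x y : N x y -> dd false (navspray x y) Fnav x y =
  2^-1 * dd true y Fnav x y.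
Proof.
move=> Nxy; have Ux := nav_base Nxy; have w0 := Wform_neq0 Nxy.
have e1 := dy_Fnav (navspray x y) Nxy; have e2 := dx_Fnav y Nxy.
have hF := FnavE Nxy; have hu := radialF Nxy.
suff E : Wform x y * dd false (navspray x y) Fnav x y =
    Wform x y * (2^-1 * dd true y Fnav x y).
  by apply: (mulfI w0).
rewrite e1 (hprodC _ _ Ux) hprod_navspray// Wform_navspray// hprod_Gamma//
  hprod_spray_shift// subrr mulr0 subr0.
transitivity (4^-1 * (2 * Wform x y * dd true y Fnav x y)); last by field.
rewrite e2 -hF.
rewrite (_ : covW x y y = covW x y (Wfield x) * Fnav x y - radial x y * Fnav x
  y); last by rewrite hu; ring.
by field.
Qed.

(** Visible from the formula for the second derivative, as h is symmetric. *)
Lemma dyy_Fnav_sym u v x y : N x y ->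
  dd false u (dd false v Fnav) x y = dd false v (dd false u Fnav) x y.
Proof.
move=> Nxy; have Ux := nav_base Nxy; apply: (mulfI (Wform_neq0 Nxy)).
rewrite (dyy_Fnav u v Nxy) (dyy_Fnav v u Nxy).
rewrite (hprodC u v Ux).
move: (dd false u Fnav x y) (dd false v Fnav x y) => a b.
ring.
Qed.

Lemma sum_partial_Fnav k z x y : N x y ->
  \sum_j partial false k (partial false j Fnav) x y * z 0 j =
   dd false z (dd false (delta_mx 0 k) Fnav) x y.
Proof.
move=> Nxy; have Ux := nav_base Nxy; have w0 := Wform_neq0 Nxy.
rewrite ddE; apply: eq_bigr => j _; rewrite mulrC; congr (_ * _).
rewrite -!dd_delta.
have -> : dd false (delta_mx 0 k) (partial false j Fnav) x y =
          dd false (delta_mx 0 k) (dd false (delta_mx 0 j) Fnav) x y.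
  by apply: (dd_eq _ Nxy) => x1 y1 _; rewrite dd_delta.
exact: dyy_Fnav_sym.
Qed.

(** The Euler-Lagrange equations of F, contracted with the k-th basis vector. *)
Lemma dyy_Fnav_navspray k x y : N x y ->
  \sum_j partial false k (partial false j Fnav) x y * navspray x y 0 j =
  2^-1 * (dd true y (dd false (delta_mx 0 k) Fnav) x y
          - dd true (delta_mx 0 k) Fnav x y).
Proof.
move=> Nxy; have Ux := nav_base Nxy; have w0 := Wform_neq0 Nxy.
rewrite sum_partial_Fnav//.
move: (delta_mx 0 k) => z.
have e1 := dyy_Fnav (navspray x y) z Nxy; have e2 := dxy_Fnav y z Nxy; have e3 :=
  dx_Fnav z Nxy.
have e4 := dy_Fnav z Nxy.
have hu := radialF Nxy; have hG := dy_Fnav_navspray Nxy.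
suff E : Wform x y * dd false (navspray x y) (dd false z Fnav) x y =
    Wform x y * (2^-1 * (dd true y (dd false z Fnav) x y - dd true z Fnav x y)).
  by apply: (mulfI w0).
rewrite e1 hG.
transitivity (2^-1 * (Wform x y * dd true y (dd false z Fnav) x y) -
   4^-1 * (2 * Wform x y * dd true z Fnav x y)); last by field.
rewrite e2 e3 hprod_navspray// Wform_navspray// hprod_Gamma// hprod_spray_shift// -e4.
have -> : covW x z y - covW x y z = dWform x y z - dWform x z y.
  by rewrite /covW (GammaC z y Ux); ring.
rewrite (_ : covW x y y = covW x y (Wfield x) * Fnav x y - radial x y * Fnav x y);
  last by rewrite hu; ring.
by field.
Qed.

Lemma dd_Fnav2 s z x y : N x y ->
  dd s z (fun x y => Fnav x y ^+ 2) x y = 2 * (Fnav x y * dd s z Fnav x y).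
Proof.
move=> Nxy; rewrite (dd_eq (g := fun x y => Fnav x y * Fnav x y) _ Nxy) => [|x1 y1 _].
  by rewrite (ddM reg_Fnav reg_Fnav Nxy); ring.
by rewrite expr2.
Qed.

Lemma partial_Fnav2 s k x y : N x y ->
  partial s k (fun x y => Fnav x y ^+ 2) x y = 2 * (Fnav x y * partial s k Fnav x y).
Proof. by move=> Nxy; rewrite -!dd_delta dd_Fnav2. Qed.

Lemma partial_partial_Fnav2 s k l x y : N x y ->
  partial s k (partial false l (fun x y => Fnav x y ^+ 2)) x y =
  2 * (partial s k Fnav x y * partial false l Fnav x y + Fnav x y * partial s k
    (partial false l Fnav) x y).
Proof.
move=> Nxy.
rewrite (partial_eq (g := fun x y =>
  2 * (Fnav x y * partial false l Fnav x y)) _ _ _ Nxy); last first.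
  by move=> x1 y1 N1; rewrite partial_Fnav2.
have rl := reg_partial false l reg_Fnav.
by rewrite -[LHS]dd_delta (ddZ (regM reg_Fnav rl) Nxy) (ddM reg_Fnav rl Nxy)
  !dd_delta.
Qed.

Lemma fundamental_tensorE x y i j : N x y -> fundamental_tensor Fnav x y i j =
  partial false i Fnav x y * partial false j Fnav x y + Fnav x y * partial false
    i (partial false j Fnav) x y.
Proof.
move=> Nxy; rewrite mxE.
rewrite -[X in _ * X]/(partial false i (partial false j (fun x y =>
  Fnav x y ^+ 2)) x y).
rewrite partial_partial_Fnav2// mulrA mulVf ?mul1r// ?pnatr_eq0//.
Qed.

Lemma fundamental_tensor_sym x y : N x y ->
  (fundamental_tensor Fnav x y)^T = fundamental_tensor Fnav x y.
Proof.
move=> Nxy; apply/matrixP => i j.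
rewrite mxE (fundamental_tensorE j i Nxy) (fundamental_tensorE i j Nxy).
have E a b : partial false a (partial false b Fnav) x y =
    dd false (delta_mx 0 a) (dd false (delta_mx 0 b) Fnav) x y.
  rewrite -dd_delta; apply: (dd_eq _ Nxy) => x1 y1 _; by rewrite dd_delta.
rewrite !E (dyy_Fnav_sym (delta_mx 0 j) _ Nxy).
by move: (partial false j Fnav x y) (partial false i Fnav x y) => p q;
  rewrite (mulrC p).
Qed.

Lemma fundamental_tensor_mulE x y z k : N x y ->
  \sum_j fundamental_tensor Fnav x y k j * z 0 j =
  partial false k Fnav x y * dd false z Fnav x y +
  Fnav x y * dd false z (dd false (delta_mx 0 k) Fnav) x y.
Proof.
move=> Nxy; rewrite -sum_partial_Fnav// mulr_sumr ddE mulr_sumr -big_split/=.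
apply: eq_bigr => j _; rewrite (fundamental_tensorE k j Nxy).
move: (partial false k Fnav x y) (partial false j Fnav x y) => a b.
move: (partial false k (partial false j Fnav) x y) => c.
ring.
Qed.

(** The tensor is dF dF + F F'', where F'' annihilates y and dF(y) = F.  Pairing a
    kernel vector z with y gives dF(z) = 0, hence F''(z) = 0.  By the formula for
    F'' this means h(z,v) = w(z) dF(v) for all v; taking v = W gives
    w(z) F = 0, and so z = 0. *)
Lemma fundamental_tensor_unit x y : N x y ->
  fundamental_tensor Fnav x y \in unitmx.
Proof.
move=> Nxy; have Ux := nav_base Nxy; have w0 := Wform_neq0 Nxy.
have F0 := lt0r_neq0 (Fnav_gt0 Nxy); have hF := FnavE Nxy.
rewrite -row_free_unit -kermx_eq0; apply/eqP/row_matrixP => a; rewrite row0.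
set z := row a _.
have zg : z *m fundamental_tensor Fnav x y = 0 by rewrite /z -row_mul mulmx_ker row0.
have E k : partial false k Fnav x y * dd false z Fnav x y +
    Fnav x y * dd false z (dd false (delta_mx 0 k) Fnav) x y = 0.
  rewrite -fundamental_tensor_mulE//.
  transitivity ((z *m (fundamental_tensor Fnav x y)^T) 0 k).
    by rewrite mxE; apply: eq_bigr => j _; rewrite [X in _ = _ * X]mxE mulrC.
  by rewrite fundamental_tensor_sym// zg mxE.
have E' v : dd false v Fnav x y * dd false z Fnav x y +
    Fnav x y * dd false z (dd false v Fnav) x y = 0.
  have -> : dd false z (dd false v Fnav) x y =
     \sum_k v 0 k * dd false z (dd false (delta_mx 0 k) Fnav) x y.
    rewrite (dd_eq (g := fun x y => \sum_k v 0 k * partial false k Fnav x y) _ Nxy);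
      last by move=> x1 y1 _; rewrite ddE.
    rewrite (dd_sum (J := J) _ Nxy); last first.
      by move=> k; apply: regM; [exact: reg_cst|exact/reg_partial/reg_Fnav].
    apply: eq_bigr => k _; rewrite (ddZ (J := J) _ Nxy);
      last exact/reg_partial/reg_Fnav.
    by congr (_ * _); apply: (dd_eq _ Nxy) => x1 y1 _; rewrite dd_delta.
  rewrite (ddE false v) mulr_suml mulr_sumr -big_split/= big1// => k _.
  by rewrite -(mulr0 (v 0 k)) -(E k); ring.
have yF : dd false y Fnav x y = Fnav x y.
  by apply: (mulfI w0); rewrite dy_Fnav// -hF; ring.
have zF : dd false z Fnav x y = 0.
  have := E' y.
  have -> : dd false z (dd false y Fnav) x y = 0.
    apply: (mulfI w0); rewrite dyy_Fnav// mulr0 yF.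
    have := dy_Fnav z Nxy; rewrite (hprodC z y Ux); lra.
  by rewrite yF mulr0 addr0 => /eqP; rewrite mulf_eq0 (negbTE F0) => /eqP.
have zz v : hprod x z v = Wform x z * dd false v Fnav x y.
  have := E' v; rewrite zF mulr0 add0r => /eqP; rewrite mulf_eq0 (negbTE F0)/=.
  move=> /eqP h; have := dyy_Fnav z v Nxy; rewrite h zF; lra.
have omz : Wform x z = 0.
  have := zz y; rewrite yF (hprodC _ _ Ux) => h.
  have := dy_Fnav z Nxy; rewrite zF mulr0 h => h2.
  have := zz (Wfield x); rewrite hprod_Wfieldr//.
  have := dy_Fnav (Wfield x) Nxy; rewrite Wform_Wfield// hprod_Wfieldr// mulr1 =>
    h3 h4.
  have : Wform x z * Fnav x y = 0.
    by have := congr1 ( *%R (Wform x y)) h4; rewrite mulrCA h3; lra.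
  by move=> /eqP; rewrite mulf_eq0 (negbTE F0) orbF => /eqP.
apply: (hprod_inj Ux) => v; rewrite zz omz mul0r; by rewrite hprod_lin.
Qed.

(** Since the fundamental tensor is invertible, it suffices to multiply by it; the
    right-hand side of the spray equation is 2 (e F_l + F E_l), where e is the
    derivative of F along y in x and E the Euler-Lagrange expression of F. *)
Lemma spray_Fnav i x y : N x y -> spray Fnav i x y = navspray x y 0 i.
Proof.
move=> Nxy; rewrite /spray.
set rhs : V := \row_l ((\sum_k partial true k (partial false l (fun x y =>
  Fnav x y ^+ 2)) x y * y 0 k)
     - partial true l (fun x y => Fnav x y ^+ 2) x y).
have gU := fundamental_tensor_unit Nxy.
have key : fundamental_tensor Fnav x y *m (navspray x y)^T = 4^-1 *: rhs^T.
  apply/colP => k; rewrite [LHS]mxE [RHS]mxE [X in _ = _ * X]mxE.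
  transitivity (\sum_j fundamental_tensor Fnav x y k j * navspray x y 0 j).
    by apply: eq_bigr => j _; rewrite [(navspray x y)^T j 0]mxE.
  rewrite fundamental_tensor_mulE// dy_Fnav_navspray// -sum_partial_Fnav//
    dyy_Fnav_navspray// mxE.
  rewrite partial_Fnav2//.
  have -> : \sum_k0 partial true k0 (partial false k (fun x y =>
    Fnav x y ^+ 2)) x y * y 0 k0
     = 2 * (dd true y Fnav x y * partial false k Fnav x y +
         Fnav x y * dd true y (dd false (delta_mx 0 k) Fnav) x y).
    have -> : dd true y (dd false (delta_mx 0 k) Fnav) x y =
      dd true y (partial false k Fnav) x y.
      by apply: (dd_eq _ Nxy) => x1 y1 _; rewrite dd_delta.
    rewrite !(ddE true y) mulr_suml mulr_sumr -big_split/= mulr_sumr.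
    by apply: eq_bigr => j _; rewrite partial_partial_Fnav2//; ring.
  by rewrite dd_delta; field.
have -> : navspray x y 0 i = (4^-1 *: (invmx (fundamental_tensor Fnav x y) *m
  rhs^T)) i 0.
  by rewrite scalemxAr -key mulKmx// [RHS]mxE.
rewrite mxE; congr (_ * _); rewrite mxE; apply: eq_bigr => l _.
by congr (_ * _); rewrite !mxE.
Qed.

(** * Restriction to lines and homogeneity *)

Lemma cone_line x y v (t : R) : N x y -> Wform x v = 0 -> N x (y + t *: v).
Proof.
move=> /nav_coneP[Ux y0] v0; apply/nav_coneP; split => //.
by rewrite linD linZ [X in t * X]v0 mulr0 addr0.
Qed.

(** Only invertible factors could produce a denominator, and those allowed here
    are constant along the line. *)
Lemma line_poly f x y v : reg N J f -> N x y -> Wform x v = 0 ->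
  exists p : {poly R}, forall t, f x (y + t *: v) = p.[t].
Proof.
move=> rf Nxy v0; elim: rf => {f}
  [c cU|i|f g _ [p fp] _ [q gq]|f g _ [p fp] _ [q gq]|f _ _ Jf f0|f g _ [p fp] fg].
- by exists (c x)%:P => t; rewrite hornerC.
- by exists ((y 0 i)%:P + v 0 i *: 'X) => t; rewrite !hornerE !mxE mulrC.
- by exists (p + q) => t; rewrite hornerD fp gq.
- by exists (p * q) => t; rewrite hornerM fp gq.
- exists ((f x y)^-1)%:P => t; rewrite hornerC Jf//; first exact: nav_base Nxy.
  by rewrite linZ [X in t * X]v0 mulr0.
- by exists p => t; rewrite -fg ?fp//; exact: cone_line.
Qed.

Definition covW_mx x : 'M[R]_n := \matrix_(k, l) covW x (delta_mx 0 k) (delta_mx 0 l).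

Lemma covW_bil x u v : base N x -> covW x u v = bil (covW_mx x) u v.
Proof.
move=> Ux; rewrite bilE.
rewrite (basis_expansion (f := fun u => covW x u v)); [|by move=> *;
  rewrite covW_lin..].
apply: eq_bigr => k _.
rewrite (basis_expansion (f := fun v => covW x (delta_mx 0 k) v)); [|by move=> *;
  rewrite covW_lin..].
by rewrite mulr_suml; apply: eq_bigr => l _; rewrite mxE mulrAC.
Qed.

Lemma reg_covW_mx i j : reg N J (fun x _ => covW_mx x i j).
Proof.
apply: reg_eq (reg_covW (regv_cst (delta_mx 0 i)) (regv_cst (delta_mx 0 j))) _.
by move=> x y _; rewrite mxE.
Qed.

(** Homogeneity is expressed by Euler's relation, the only form in which it is
    used; it is inherited by sums and products through the Leibniz rule. *)
Definition homog (d : nat) (f : V -> V -> R) :=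
  forall x y, N x y -> dd false y f x y = d%:R * f x y.

Lemma homog_eq d f g : eq_dom N f g -> homog d f -> homog d g.
Proof.
move=> fg hf x y Nxy; rewrite -fg// -hf//; apply/esym.
exact: (dd_eq fg Nxy).
Qed.

Lemma homogD d f g : reg N J f -> reg N J g -> homog d f -> homog d g ->
  homog d (fun x y => f x y + g x y).
Proof.
by move=> rf rg hf hg x y Nxy; rewrite (ddD rf rg Nxy) hf// hg//; ring.
Qed.

Lemma homogM d e f g : reg N J f -> reg N J g -> homog d f -> homog e g ->
  homog (d + e) (fun x y => f x y * g x y).
Proof.
by move=> rf rg hf hg x y Nxy; rewrite (ddM rf rg Nxy) hf// hg// natrD; ring.
Qed.

Lemma homogZ d c f : reg N J f -> homog d f -> homog d (fun x y => c * f x y).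
Proof.
by move=> rf hf x y Nxy; rewrite (ddZ rf Nxy) hf//; ring.
Qed.

Lemma homog_coord k : homog 1 (fun _ y => y 0 k).
Proof. by move=> x y _; rewrite dd_coord mul1r. Qed.

Lemma homog_xonly (c : V -> R) : homog 0 (fun x _ => c x).
Proof. by move=> x y _; rewrite dd_xonly mul0r. Qed.

Lemma homog_bil_yy (A : V -> 'M[R]_n) : (forall i j, reg N J (fun x _ => A x i j)) ->
  homog 2 (fun x y => bil (A x) y y).
Proof.
move=> rA x y Nxy.
rewrite (dd_bil _ _ rA (@regv_y) (@regv_y) Nxy) ddv_y; ring.
Qed.

Lemma homog_bil_y (A : V -> 'M[R]_n) (u : V -> V) :
  (forall i j, reg N J (fun x _ => A x i j)) ->
  regv (fun x _ => u x) -> homog 1 (fun x y => bil (A x) y (u x)).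
Proof.
move=> rA ru x y Nxy.
rewrite (dd_bil _ _ rA (@regv_y) ru Nxy) ddv_y.
rewrite (_ : ddv _ _ (fun x _ => u x) _ _ = 0); first by rewrite bil0r; ring.
by apply/rowP => k; rewrite !mxE (dd_xonly y (fun x => u x 0 k)).
Qed.

Lemma homog_covW_Wfield : homog 1 (fun x y => covW x y (Wfield x)).
Proof.
apply: homog_eq (homog_bil_y reg_covW_mx regv_Wfield) => x y /nav_base Ux.
by rewrite covW_bil.
Qed.

Lemma homog_covW_yy : homog 2 (fun x y => covW x y y).
Proof.
by apply: homog_eq (homog_bil_yy reg_covW_mx) => x y /nav_base Ux; rewrite covW_bil.
Qed.

Lemma homog_Wform : homog 1 (fun x y => Wform x y).
Proof. by move=> x y Nxy; rewrite dy_Wform// mul1r. Qed.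

Lemma homog_Fnav : homog 1 Fnav.
Proof.
move=> x y Nxy; apply: (mulfI (Wform_neq0 Nxy)); rewrite dy_Fnav// -(FnavE Nxy); ring.
Qed.

Definition Gamma_mx i x : 'M[R]_n := \matrix_(j, k) christoffel (hmetric N) i j k x.

Lemma Gamma_bil i x u v : Gamma x u v 0 i = bil (Gamma_mx i x) u v.
Proof.
rewrite bilE mxE; apply: eq_bigr => j _; apply: eq_bigr => k _.
by rewrite mxE.
Qed.

Lemma reg_Gamma_mx a i j : reg N J (fun x _ => Gamma_mx a x i j).
Proof.
by apply: reg_eq (reg_christoffel a i j) _ => x y _; rewrite mxE.
Qed.

Lemma homog_Gamma i : homog 2 (fun x y => Gamma x y y 0 i).
Proof.
apply: homog_eq (homog_bil_yy (reg_Gamma_mx i)) => x y _; by rewrite Gamma_bil.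
Qed.

Lemma regv_curlW : regv curlW.
Proof.
apply: regv_raise => k; apply: reg_eq (regB (f := fun x y => covW x (delta_mx 0 k) y)
  (g := fun x y => covW x y (delta_mx 0 k)) _ _) _.
- by apply: reg_covW; [exact: regv_cst|exact: regv_y].
- by apply: reg_covW; [exact: regv_y|exact: regv_cst].
by move=> x y _; rewrite mxE.
Qed.

Definition curlW_row i x : V :=
  (col i (((covW_mx x)^T - covW_mx x) *m invmx (hmetric N x)))^T.

Lemma curlW_lin i x y : base N x -> curlW x y 0 i = lin (curlW_row i x) y.
Proof.
move=> Ux; rewrite /curlW /raise.
have -> : \row_k (covW x (delta_mx 0 k) y - covW x y (delta_mx 0 k)) =
    y *m ((covW_mx x)^T - covW_mx x).
  apply/rowP => k; rewrite !mxE.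
  rewrite (basis_expansion (f := fun y => covW x (delta_mx 0 k) y));
    [|by move=> *; rewrite covW_lin..].
  rewrite (basis_expansion (f := fun y => covW x y (delta_mx 0 k)));
    [|by move=> *; rewrite covW_lin..].
  by rewrite -sumrB; apply: eq_bigr => j _; rewrite !mxE; ring.
rewrite -mulmxA mxE linE; apply: eq_bigr => k _.
by rewrite [_^T _ _]mxE [col _ _ _ _]mxE mulrC.
Qed.

Lemma regv_curlW_row i : regv (fun x _ => curlW_row i x).
Proof.
move=> k; apply: (@reg_eq _ _ _ _ (fun x _ =>
  \sum_l (covW_mx x l k - covW_mx x k l) * invmx (hmetric N x) l i)); last first.
  by move=> x y _; rewrite !mxE; apply: eq_bigr => l _; rewrite !mxE.
apply: reg_sum => l _; apply: regM; last exact: reg_invmx_hmetric.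
by apply: regB; exact: reg_covW_mx.
Qed.

Lemma homog_lin (p : V -> V) : regv (fun x _ => p x) ->
  homog 1 (fun x y => lin (p x) y).
Proof.
by move=> rp x y Nxy; rewrite (dd_lin _ _ rp (@regv_y) Nxy) ddv_y; ring.
Qed.

Lemma homog_curlW i : homog 1 (fun x y => curlW x y 0 i).
Proof.
apply: homog_eq (homog_lin (regv_curlW_row i)) => x y /nav_base Ux.
by rewrite curlW_lin.
Qed.

(** * The pole of the spray along H = 0 *)

(** The spray without its term with denominator H.  That term, [polar], is
    proportional to y. *)
Definition tame_spray x y : V := 2^-1 *: (Gamma x y y + covW x y (Wfield x) *: y -
   (covW x y (Wfield x) * Fnav x y - covW x y y) *: Wfield x - Fnav x y *: curlW x y).
Definition polar x y : R := - (Wform x y * covW x y y) * (hprod x y y)^-1.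
Definition polar_num x y : R := Wform x y * covW x y y.

Lemma navspray_split x y : N x y -> navspray x y = tame_spray x y + polar x y *: y.
Proof.
move=> Nxy; rewrite /navspray /tame_spray /spray_shift.
have -> : radial x y = covW x y (Wfield x) + 2 * polar x y.
  rewrite /radial /polar; congr (_ + _).
  have h0 := FnavE Nxy; have F0 := lt0r_neq0 (Fnav_gt0 Nxy).
  have w0 := Wform_neq0 Nxy; rewrite -h0; field; by rewrite F0 w0.
have -> : covW x y y = - (2 * polar x y) * Fnav x y.
  rewrite /polar -(FnavE Nxy).
  have F0 := lt0r_neq0 (Fnav_gt0 Nxy).
  have w0 := Wform_neq0 Nxy; field; by rewrite F0 w0.
move: (polar x y) (covW x y (Wfield x)) (curlW x y) (Gamma x y y) (Fnav x y)
  (Wfield x) => P d S g f W.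
apply/rowP => i; by rewrite !mxE; field.
Qed.

(** Allows every nonvanishing function to be inverted, in particular H. *)
Definition unrestricted (f : V -> V -> R) := True.

Lemma reg_unrestricted f : reg N J f -> reg N unrestricted f.
Proof. exact: reg_mono. Qed.

Lemma regv_tame_spray : regv tame_spray.
Proof.
have rd : reg N J (fun x y => covW x y (Wfield x)).
  by apply: reg_covW; [exact: regv_y|exact: regv_Wfield].
have rc : reg N J (fun x y => covW x y y) by apply: reg_covW; exact: regv_y.
have rF := reg_Fnav.
move=> k; apply: (@reg_eq _ _ _ _ (fun x y => 2^-1 * (Gamma x y y 0 k +
  covW x y (Wfield x) * y 0 k - (covW x y (Wfield x) * Fnav x y - covW x y y) *
    Wfield x 0 k
  - Fnav x y * curlW x y 0 k))); last by move=> x y _; rewrite !mxE.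
apply: regM; first exact: reg_cst.
apply: regB; [apply: regB; [apply: regD|]|].
- by apply: (regv_Gamma (@regv_y) (@regv_y)).
- by apply: regM; [exact: rd|exact: reg_coord].
- by apply: regM; [apply: regB => //; exact: regM|exact: regv_Wfield].
- by apply: regM => //; exact: regv_curlW.
Qed.

Lemma reg_polar_num : reg N J polar_num.
Proof.
apply: regM; first exact: reg_Wform_y.
by apply: reg_covW; exact: regv_y.
Qed.

Lemma hprod_yy_gt0 x y : N x y -> 0 < hprod x y y.
Proof.
by move=> Nxy; rewrite -(FnavE Nxy) mulr_gt0 ?Fnav_gt0// mulr_gt0 ?Wform_gt0.
Qed.

Lemma reg_polar : reg N unrestricted polar.
Proof.
apply: regM; first exact: (regN (reg_unrestricted reg_polar_num)).
apply: regV => // [|x y Nxy]; first exact/reg_unrestricted/reg_hprod_yy.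
by rewrite gt_eqF// hprod_yy_gt0.
Qed.

Lemma reg_navspray k : reg N unrestricted (fun x y => navspray x y 0 k).
Proof.
apply: reg_eq (regD (f := fun x y => tame_spray x y 0 k) (g := fun x y =>
  polar x y * y 0 k) _ _) _.
- exact/reg_unrestricted/regv_tame_spray.
- by apply: regM; [exact: reg_polar|exact: reg_coord].
by move=> x y Nxy; rewrite navspray_split// [RHS]mxE; congr (_ + _); rewrite mxE.
Qed.

(** The contraction v^k R^i_k of the Riemann curvature of an arbitrary spray G. *)
Definition curv (G : V -> V -> V) v i x y : R :=
  2 * dd true v (fun x y => G x y 0 i) x y
  - dd true y (dd false v (fun x y => G x y 0 i)) x y
  + 2 * dd false (G x y) (dd false v (fun x y => G x y 0 i)) x y
  - dd false (ddv false v G x y) (fun x y => G x y 0 i) x y.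

Lemma curv_eq G1 G2 v i x y : (forall x y, N x y -> G1 x y = G2 x y) -> N x y ->
  curv G1 v i x y = curv G2 v i x y.
Proof.
move=> G12 Nxy; rewrite /curv.
have E j : eq_dom N (fun x y => G1 x y 0 j) (fun x y => G2 x y 0 j).
  by move=> a b Nab; rewrite G12.
have E2 s z : eq_dom N (dd s z (fun x y => G1 x y 0 i)) (dd s z (fun x y =>
  G2 x y 0 i)).
  by move=> a b; apply: dd_eq; exact: E.
rewrite (dd_eq (E i) Nxy) (dd_eq (E2 _ _) Nxy) (dd_eq (E2 _ _) Nxy) G12//.
rewrite (dd_eq (E i) Nxy).
suff -> : ddv false v G1 x y = ddv false v G2 x y by [].
by apply/rowP => j; rewrite !mxE (dd_eq (E j) Nxy).
Qed.

Lemma spray_eq F1 F2 i : eq_dom N F1 F2 -> eq_dom N (spray F1 i) (spray F2 i).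
Proof.
move=> F12.
have E : eq_dom N (fun x y => F1 x y ^+ 2) (fun x y => F2 x y ^+ 2).
  by move=> x y Nxy; rewrite F12.
have E2 s k : eq_dom N (partial s k (fun x y =>
  F1 x y ^+ 2)) (partial s k (fun x y => F2 x y ^+ 2)).
  exact: partial_eq.
move=> x y Nxy; rewrite /spray.
have -> : fundamental_tensor F1 x y = fundamental_tensor F2 x y.
  apply/matrixP => a b; rewrite [LHS]mxE [RHS]mxE.
  exact: (congr1 ( *%R 2^-1) (partial_eq false a (E2 false b) Nxy)).
apply: (congr1 ( *%R 4^-1)); apply: eq_bigr => l _.
have e1 : \sum_k partial true k (partial false l (fun x y =>
  F1 x y ^+ 2)) x y * y 0 k =
    \sum_k partial true k (partial false l (fun x y => F2 x y ^+ 2)) x y * y 0 k.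
  apply: eq_bigr => k _.
  exact: (congr1 ( *%R^~ (y 0 k)) (partial_eq true k (E2 false l) Nxy)).
exact: (congr2 (fun p q => _ * (p - q)) e1 (E2 true l _ _ Nxy)).
Qed.

Lemma riemann_curv F v i x y : eq_dom N F Fnav -> N x y ->
  \sum_k v 0 k * riemann_curvature F i k x y = curv navspray v i x y.
Proof.
move=> FF Nxy.
have S j : eq_dom N (spray F j) (fun x y => navspray x y 0 j).
  by move=> a b Nab; rewrite (spray_eq j FF Nab) spray_Fnav.
have S2 s k j : eq_dom N (partial s k (spray F j)) (partial s k (fun x y =>
  navspray x y 0 j)).
  exact: partial_eq.
have E k : riemann_curvature F i k x y =
    2 * partial true k (fun x y => navspray x y 0 i) x y
    - \sum_j y 0 j * partial true j (partial false k (fun x y =>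
        navspray x y 0 i)) x y
    + 2 * (\sum_j navspray x y 0 j * partial false j (partial false k (fun x y =>
      navspray x y 0 i)) x y)
    - \sum_j partial false j (fun x y =>
        navspray x y 0 i) x y * partial false k (fun x y => navspray x y 0 j) x y.
  have e1 := S2 true k i _ _ Nxy.
  have e2 j : partial true j (partial false k (spray F i)) x y =
      partial true j (partial false k (fun x y => navspray x y 0 i)) x y.
    exact: (partial_eq true j (S2 false k i) Nxy).
  have e3 j : spray F j x y * partial false j (partial false k (spray F i)) x y =
      navspray x y 0 j * partial false j (partial false k (fun x y =>
        navspray x y 0 i)) x y.
    exact: (congr2 *%R (S j _ _ Nxy) (partial_eq false j (S2 false k i) Nxy)).
  have e4 j : partial false j (spray F i) x y * partial false k (spray F j) x y =
      partial false j (fun x y => navspray x y 0 i) x y * partial false k (fun x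
        y => navspray x y 0 j) x y.
    exact: (congr2 *%R (S2 false j i _ _ Nxy) (S2 false k j _ _ Nxy)).
  rewrite -e1; under [X in _ = _ - X + _ - _]eq_bigr => j _ do rewrite -e2.
  under [X in _ = _ - _ + 2 * X - _]eq_bigr => j _ do rewrite -e3.
  by under [X in _ = _ - _ + _ - X]eq_bigr => j _ do rewrite -e4.
have rG j := reg_navspray j.
pose g := fun x y => navspray x y 0 i; have rg : reg N unrestricted g := rG i.
under eq_bigr => k _ do rewrite E mulrBr mulrDr mulrBr.
rewrite big_split sumrN big_split big_split sumrN /=; congr (_ - _ + _ - _).
- by rewrite ddE mulr_sumr; apply: eq_bigr => k _; rewrite mulrCA.
- rewrite ddE; under eq_bigr => k _ do rewrite mulr_sumr.
  rewrite exchange_big; apply: eq_bigr => j _.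
  rewrite -[in RHS]dd_delta (dd_eq (g := fun x y =>
    \sum_k v 0 k * partial false k g x y) _ Nxy);
    last by move=> a b _; rewrite ddE.
  rewrite (dd_sum (J := unrestricted) _ Nxy) ?mulr_sumr; last first.
    by move=> k; apply: regM; [exact: reg_cst|exact: reg_partial].
  apply: eq_bigr => k _; rewrite (ddZ (reg_partial false k rg) Nxy) dd_delta.
  by rewrite mulrCA.
- rewrite ddE; under eq_bigr => k _ do rewrite mulrCA mulr_sumr.
  rewrite -mulr_sumr exchange_big; congr (_ * _); apply: eq_bigr => j _.
  rewrite -[in RHS]dd_delta (dd_eq (g := fun x y =>
    \sum_k v 0 k * partial false k g x y) _ Nxy);
    last by move=> a b _; rewrite ddE.
  rewrite (dd_sum (J := unrestricted) _ Nxy) ?mulr_sumr; last first.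
    by move=> k; apply: regM; [exact: reg_cst|exact: reg_partial].
  apply: eq_bigr => k _; rewrite (ddZ (reg_partial false k rg) Nxy) dd_delta.
  by rewrite mulrCA.
- rewrite ddE; under eq_bigr => k _ do rewrite mulr_sumr.
  rewrite exchange_big; apply: eq_bigr => j _.
  rewrite mxE ddE mulr_suml; apply: eq_bigr => k _.
  by rewrite mulrCA mulrC mulrAC mulrC mulrA.
Qed.

(** A projective change.  The term with al is a multiple of y and disappears after
    contraction with a covector that annihilates y; when P has a simple pole and A
    none, the only double poles left are in the coefficient of v. *)
Lemma curv_projective (A : V -> V -> V) (P : V -> V -> R) v x y :
  (forall k, reg N unrestricted (fun x y => A x y 0 k)) ->
    reg N unrestricted P -> N x y ->
  (forall i, dd false y (fun x y => A x y 0 i) x y = 2 * A x y 0 i) ->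
  dd false y P x y = P x y ->
  exists al, forall i,
  curv (fun x y => A x y + P x y *: y) v i x y =
  curv A v i x y + y 0 i * al
  + v 0 i * (2 * dd false (A x y) P x y + P x y ^+ 2 - dd true y P x y)
  + 2 * P x y * (dd false y (dd false v (fun x y => A x y 0 i)) x y
                 - dd false v (fun x y => A x y 0 i) x y).
Proof.
move=> rA rP Nxy hA hP.
exists (2 * dd true v P x y - dd true y (dd false v P) x y
  + 2 * (dd false (A x y) (dd false v P) x y + P x y * dd false y (dd false v P) x y)
  + 2 * P x y * dd false v P x y
  - (dd false (ddv false v A x y) P x y + dd false v P x y * P x y + P x y * dd
      false v P x y)
  - P x y * dd false v P x y) => i.
pose a x y := A x y 0 i; have ra : reg N unrestricted a := rA i.
have ry k : reg N unrestricted (fun _ y => y 0 k) := @reg_coord _ _ N unrestricted k.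
have eg k : eq_dom N (fun x y => (A x y + P x y *: y) 0 k)
    (fun x y => A x y 0 k + P x y * y 0 k).
  by move=> x1 y1 _; rewrite !mxE.
have h1 k s z x1 y1 : N x1 y1 -> dd s z (fun x y => (A x y + P x y *: y) 0 k) x1 y1 =
    dd s z (fun x y => A x y 0 k) x1 y1
    + (dd s z P x1 y1 * y1 0 k + P x1 y1 * (if s then 0 else z 0 k)).
  move=> N1; rewrite (dd_eq (eg k) N1) (ddD (rA k) (regM rP (ry k)) N1).
  by rewrite (ddM rP (ry k) N1) dd_coord.
have h2 s z : dd s z (dd false v (fun x y => (A x y + P x y *: y) 0 i)) x y =
    dd s z (dd false v a) x y
    + (dd s z (dd false v P) x y * y 0 i + dd false v P x y * (if s then 0 else z 0 i)
       + dd s z P x y * v 0 i).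
  rewrite (dd_eq (g := fun x y => dd false v a x y +
     (dd false v P x y * y 0 i + v 0 i * P x y)) _ Nxy); last first.
    by move=> x1 y1 N1; rewrite h1//=; congr (_ + (_ + _)); exact: mulrC.
  have r1 := reg_dd false v ra; have r2 := reg_dd false v rP.
  have r3 := regM r2 (ry i); have r4 := regM (reg_cst (D :=
    N) unrestricted (v 0 i)) rP.
  rewrite (ddD r1 (regD r3 r4) Nxy) (ddD r3 r4 Nxy) (ddM r2 (ry i) Nxy) (ddZ rP Nxy).
  by rewrite dd_coord [v 0 i * _]mulrC.
have h3 : ddv false v (fun x y => A x y + P x y *: y) x y =
    ddv false v A x y + dd false v P x y *: y + P x y *: v.
  by apply/rowP => k; rewrite mxE h1// !mxE addrA.
rewrite /curv h3 !h2 !h1// !(dd_vD, dd_vZ) hA hP -/a.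
rewrite !mxE -/(a x y).
have -> : (fun x y => A x y 0 i) = a by [].
move: (dd true y (dd false v a) x y) (dd true v a x y)
 (dd false (A x y) (dd false v a) x y) (dd false (ddv false v A x y) a x y)
 (dd false y (dd false v a) x y) (dd false v a x y) (a x y)
 (dd true v P x y) (dd true y (dd false v P) x y)
 (dd false (A x y) (dd false v P) x y) (dd false y (dd false v P) x y)
 (dd false (A x y) P x y)
 (dd false (ddv false v A x y) P x y) (dd false v P x y) (P x y) (dd true y P x y).
move=> *; ring.
Qed.

Lemma reg_covW_Wfield : reg N J (fun x y => covW x y (Wfield x)).
Proof. by apply: reg_covW; [exact: regv_y|exact: regv_Wfield]. Qed.
Lemma reg_covW_yy : reg N J (fun x y => covW x y y).
Proof. by apply: reg_covW; exact: regv_y. Qed.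

Lemma homog_tame_spray i : homog 2 (fun x y => tame_spray x y 0 i).
Proof.
have rd := reg_covW_Wfield; have rc := reg_covW_yy; have rF := reg_Fnav.
have hd := @homog_covW_Wfield; have hc := @homog_covW_yy; have hF := @homog_Fnav.
have rg : reg N J (fun x y => Gamma x y y 0 i) := regv_Gamma (@regv_y) (@regv_y) i.
have ry : reg N J (fun _ y => y 0 i) := @reg_coord _ _ N J i.
have rW : reg N J (fun x _ => Wfield x 0 i) := regv_Wfield i.
have rs : reg N J (fun x y => curlW x y 0 i) := @regv_curlW i.
have r1 := regM rd ry; have r2 := regM rd rF; have r3 := regN rc.
have r4 := regN (regM (regD r2 r3) rW); have r5 := regN (regM rF rs).
have homN d f : reg N J f -> homog d f -> homog d (fun x y => - f x y).
  move=> rf hf; apply: (@homog_eq d (fun x y => (-1) * f x y)).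
    by move=> x y _; rewrite mulN1r.
  exact: homogZ rf hf.
have h1 : homog 2 (fun x y => covW x y (Wfield x) * y 0 i).
  exact: (homogM rd ry hd (@homog_coord i)).
have h2 : homog 2 (fun x y => covW x y (Wfield x) * Fnav x y) := homogM rd rF hd hF.
have h23 : homog 2 (fun x y =>
  (covW x y (Wfield x) * Fnav x y + - covW x y y) * Wfield x 0 i).
  apply: (homogM (regD r2 r3) rW (homogD r2 r3 h2 (homN _ _ rc hc))).
  exact: (@homog_xonly (fun x => Wfield x 0 i)).
have h5 : homog 2 (fun x y => Fnav x y * curlW x y 0 i) :=
  homogM rF rs hF (@homog_curlW i).
have hall := homogZ 2^-1 (regD (regD (regD rg r1) r4) r5)
  (homogD (regD (regD rg r1) r4) r5 (homogD (regD rg r1) r4 (homogD rg r1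
    (@homog_Gamma i) h1)
    (homN _ _ (regM (regD r2 r3) rW) h23)) (homN _ _ (regM rF rs) h5)).
apply: homog_eq hall => x y _; by rewrite !mxE.
Qed.

Lemma homog_polar_num : homog 3 polar_num.
Proof.
exact: (homogM reg_Wform_y reg_covW_yy (@homog_Wform) (@homog_covW_yy)).
Qed.

Lemma polarE x y : N x y -> polar x y * hprod x y y = - polar_num x y.
Proof.
by move=> Nxy; rewrite /polar mulfVK// gt_eqF// hprod_yy_gt0.
Qed.

Lemma dd_polar s z x y : N x y ->
  dd s z polar x y * hprod x y y + polar x y * dd s z (fun x y => hprod x y y) x y
  = - dd s z polar_num x y.
Proof.
move=> Nxy; have rH := reg_unrestricted reg_hprod_yy; have rr :=
  reg_unrestricted (@reg_polar_num).
rewrite -(ddM reg_polar rH Nxy) -mulN1r -(ddZ rr Nxy).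
by apply: (dd_eq _ Nxy) => x1 y1 N1; rewrite polarE// mulN1r.
Qed.

Lemma homog_polar x y : N x y -> dd false y polar x y = polar x y.
Proof.
move=> Nxy; have H0 := hprod_yy_gt0 Nxy.
have := dd_polar false y Nxy; rewrite homog_polar_num// (dy_hprod_yy y Nxy)
  -mulrN -polarE//.
by move=> h; apply: (mulIf (lt0r_neq0 H0)); move: h; lra.
Qed.

Definition simple_pole x y : R :=
  dd true y polar_num x y - 2 * dd false (tame_spray x y) polar_num x y +
    polar_num x y * covW x y (Wfield x).

(** In the first term one recognizes the derivative of H along y in x, which is
    what remains of the connection of h. *)
Lemma hprod_tame_spray x y : N x y -> 4 * hprod x y (tame_spray x y) =
  dhprod x y y y + covW x y (Wfield x) * hprod x y y + 2 * polar_num x y.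
Proof.
move=> Nxy; have Ux := nav_base Nxy; have hF := FnavE Nxy.
have -> : hprod x y (tame_spray x y) =
  2^-1 * (hprod x y (Gamma x y y) + covW x y (Wfield x) * hprod x y y -
   (covW x y (Wfield x) * Fnav x y - covW x y y) * hprod x y (Wfield x) - Fnav x
     y * hprod x y (curlW x y)).
  by rewrite /tame_spray; move: (Gamma x y y) (curlW x y) (Wfield x) (covW x _ _)
    => g S W d;
    rewrite !hprod_lin.
rewrite (hprodC _ (Gamma x y y) Ux) hprod_Gamma// (hprodC _ (curlW x y) Ux)
  hprod_curlW// hprod_Wfieldr//.
by rewrite /polar_num -hF; field.
Qed.

(** With rho = w D(y,y) and P = - rho / H, the square P^2 contributes rho^2 / H^2
    and differentiating the denominator of P contributes
    rho (4 h(y,A) - d_y H) / H^2, whose leading part is 2 rho^2 / H^2 by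
    [hprod_tame_spray]. *)
Lemma polar_curvature x y : N x y ->
  hprod x y y ^+ 2 * (2 * dd false (tame_spray x y) polar x y + polar x y ^+ 2 -
    dd true y polar x y) =
  3 * polar_num x y ^+ 2 + hprod x y y * simple_pole x y.
Proof.
move=> Nxy; have hA := hprod_tame_spray Nxy; have hP := polarE Nxy.
have e1 := dd_polar true y Nxy; have e2 := dd_polar false (tame_spray x y) Nxy.
rewrite (dx_hprod_yy y Nxy) in e1; rewrite (dy_hprod_yy _ Nxy) in e2.
rewrite /simple_pole; move: hA hP e1 e2.
move: (hprod x y (tame_spray x y)) (dhprod x y y y) (hprod x y y) (dd true y
  polar x y) (dd false (tame_spray x y) polar x y)
  (dd true y polar_num x y) (dd false (tame_spray x y) polar_num x y) (polar x y)
    (polar_num x y) (covW x y (Wfield x)).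
move=> iA d3 H xP yP xr yr P r d hA hP e1 e2.
have -> : xr = - (xP * H + P * d3) by rewrite e1 opprK.
have -> : yr = - (yP * H + P * (2 * iA)) by rewrite e2 opprK.
have -> : d3 = 4 * iA - d * H - 2 * r by rewrite hA; ring.
have -> : r = - (P * H) by rewrite hP opprK.
ring.
Qed.

Lemma reg_curv i v : reg N J (curv tame_spray v i).
Proof.
have rA := @regv_tame_spray; have rAi := rA i.
have rdd := reg_dd false v rAi.
apply: regB; [apply: regD; [apply: regB|]|].
- by apply: regM; [exact: reg_cst|exact: reg_dd].
- by apply: reg_ddv => // k; exact: reg_coord.
- by apply: regM; [exact: reg_cst|exact: reg_ddv].
- apply: reg_ddv => // k; apply: reg_eq (reg_dd false v (rA k)) _.
  by move=> x y _; rewrite mxE.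
Qed.

Lemma reg_simple_pole : reg N J simple_pole.
Proof.
have rr := @reg_polar_num; apply: regD; last by apply: regM => //;
  exact: reg_covW_Wfield.
apply: regB; first by apply: reg_ddv => // k; exact: reg_coord.
apply: regM; first exact: reg_cst.
by apply: reg_ddv => //; exact: regv_tame_spray.
Qed.

(** * Sprays of the form quadratic plus F times linear *)

(** Contraction with a constant covector commutes with all derivatives, so the
    curvature can be computed from the scalar function c(G). *)
Lemma curv_contract (G : V -> V -> V) (c : V) v x y : regv G -> N x y ->
  \sum_i c 0 i * curv G v i x y =
  2 * dd true v (fun x y => lin c (G x y)) x y
  - dd true y (dd false v (fun x y => lin c (G x y))) x y
  + 2 * dd false (G x y) (dd false v (fun x y => lin c (G x y))) x y
  - dd false (ddv false v G x y) (fun x y => lin c (G x y)) x y.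
Proof.
move=> rG Nxy; pose f x y := lin c (G x y).
rewrite -/f.
have E1 s z x1 y1 : N x1 y1 -> dd s z f x1 y1 =
    \sum_i c 0 i * dd s z (fun x y => G x y 0 i) x1 y1.
  move=> N1; rewrite (dd_eq (g := fun x y => \sum_i c 0 i * G x y 0 i) _ N1);
    last by move=> a b _; rewrite /f linE.
  rewrite (dd_sum (J := J) _ N1); last by move=> i; apply: regM => //; exact: reg_cst.
  by apply: eq_bigr => i _; rewrite (ddZ (rG i) N1).
have E2 s z : dd s z (dd false v f) x y =
    \sum_i c 0 i * dd s z (dd false v (fun x y => G x y 0 i)) x y.
  rewrite (dd_eq (g := fun x y => \sum_i c 0 i * dd false v (fun x y =>
    G x y 0 i) x y) _ Nxy);
    last by move=> a b Nab; rewrite E1.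
  have rd i := reg_dd false v (rG i).
  rewrite (dd_sum (J := J) _ Nxy); last by move=> i; apply: regM => //;
    exact: reg_cst.
  by apply: eq_bigr => i _; rewrite (ddZ (rd i) Nxy).
rewrite !E2 !E1// !mulr_sumr -sumrN -!big_split/= -sumrN -big_split/=.
apply: eq_bigr => i _; rewrite /curv; ring.
Qed.

(** The components of the spray have this form once W is a Killing field. *)
Section QuadraticPlusKropina.
Variables (Q : V -> 'M[R]_n) (p : V -> V).
Hypothesis rQ : forall i j, reg N J (fun x _ => Q x i j).
Hypothesis rp : forall i, reg N J (fun x _ => p x 0 i).
Variable f : V -> V -> R.
Hypothesis fE : eq_dom N f (fun x y => bil (Q x) y y - Fnav x y * lin (p x) y).

Definition dquad x z : 'M[R]_n := \matrix_(k, l) dd true z (fun x1 _ => Q x1 k l) x 0.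
Definition drow x z : V := \row_k dd true z (fun x1 _ => p x1 0 k) x 0.

Let ry := @regv_y.
Let rF := reg_Fnav.
Let rl u : reg N J (fun x y => lin (p x) (u : V)).
Proof. exact: (reg_lin rp (regv_cst u)). Qed.
Let rly : reg N J (fun x y => lin (p x) y).
Proof. exact: (reg_lin rp ry). Qed.

Let ddly s z x y : N x y -> dd s z (fun x y => lin (p x) y) x y =
  if s then lin (drow x z) y else lin (p x) z.
Proof.
move=> Nxy; rewrite (dd_lin s z rp ry Nxy) ddv_y.
by case: s; rewrite ?lin0 ?addr0 ?add0r.
Qed.

Let ddl s z u x y : N x y -> dd s z (fun x y => lin (p x) u) x y =
  if s then lin (drow x z) u else 0.
Proof.
move=> Nxy; rewrite (dd_lin s z rp (regv_cst u) Nxy) ddv_cst.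
by case: s; rewrite ?lin0 ?addr0 ?add0r.
Qed.

Let ddb s z (u v : V -> V -> V) x y : regv u -> regv v -> N x y ->
  dd s z (fun x y => bil (Q x) (u x y) (v x y)) x y =
  (if s then bil (dquad x z) (u x y) (v x y) else 0) +
  bil (Q x) (ddv s z u x y) (v x y) + bil (Q x) (u x y) (ddv s z v x y).
Proof. exact: dd_bil. Qed.

Lemma dy_quad_kropina z x y : N x y -> dd false z f x y =
  bil (Q x) z y + bil (Q x) y z - (dd false z Fnav x y * lin (p x) y + Fnav x y *
    lin (p x) z).
Proof.
move=> Nxy; rewrite (dd_eq fE Nxy).
have r1 := reg_bil rQ ry ry; have r2 := regM rF rly.
rewrite (dd_eq (g := fun x y =>
  bil (Q x) y y + (-1) * (Fnav x y * lin (p x) y)) _ Nxy);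
  last by move=> x1 y1 _; rewrite mulN1r.
rewrite (ddD r1 (regM (reg_cst _ (-1)) r2) Nxy) (ddZ r2 Nxy) (ddM rF rly Nxy).
by rewrite ddly// ddb// ddv_y mulN1r add0r.
Qed.

Lemma dx_quad_kropina z x y : N x y -> dd true z f x y =
  bil (dquad x z) y y - (dd true z Fnav x y * lin (p x) y + Fnav x y * lin (drow
    x z) y).
Proof.
move=> Nxy; rewrite (dd_eq fE Nxy).
have r1 := reg_bil rQ ry ry; have r2 := regM rF rly.
rewrite (dd_eq (g := fun x y =>
  bil (Q x) y y + (-1) * (Fnav x y * lin (p x) y)) _ Nxy);
  last by move=> x1 y1 _; rewrite mulN1r.
rewrite (ddD r1 (regM (reg_cst _ (-1)) r2) Nxy) (ddZ r2 Nxy) (ddM rF rly Nxy).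
by rewrite ddly// ddb// ddv_y bil0l bil0r !addr0 mulN1r.
Qed.

Lemma ddy_quad_kropina s z v x y : N x y -> dd s z (dd false v f) x y =
  (if s then bil (dquad x z) v y + bil (dquad x z) y v else bil (Q x) v z + bil
    (Q x) z v)
  - (dd s z (dd false v Fnav) x y * lin (p x) y
     + dd false v Fnav x y * (if s then lin (drow x z) y else lin (p x) z)
     + (dd s z Fnav x y * lin (p x) v + Fnav x y * (if s then lin (drow x z) v
       else 0))).
Proof.
move=> Nxy.
have r1 := reg_bil rQ (regv_cst v) ry; have r2 := reg_bil rQ ry (regv_cst v).
have rvF := reg_dd false v rF.
have r3 := regM rvF rly; have r4 := regM rF (rl v).
rewrite (dd_eq (g := fun x y => (bil (Q x) v y + bil (Q x) y v) +
   (-1) * (dd false v Fnav x y * lin (p x) y + Fnav x y * lin (p x) v)) _ Nxy);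
  last by move=> x1 y1 N1; rewrite dy_quad_kropina// mulN1r.
rewrite (ddD (regD r1 r2) (regM (reg_cst _ (-1)) (regD r3 r4)) Nxy).
rewrite (ddD r1 r2 Nxy) (ddZ (regD r3 r4) Nxy) (ddD r3 r4 Nxy).
rewrite (ddM rvF rly Nxy) (ddM rF (rl v) Nxy) ddly// ddl// mulN1r.
rewrite (ddb s z (regv_cst v) ry Nxy) (ddb s z ry (regv_cst v) Nxy).
rewrite ddv_cst ddv_y; congr (_ - _).
by case: s; rewrite !(bil0l, bil0r); ring.
Qed.

Lemma dyyy_quad_kropina v x y : N x y -> dd false v (dd false v (dd false v f)) x y =
  - (dd false v (dd false v (dd false v Fnav)) x y * lin (p x) y
     + 3 * dd false v (dd false v Fnav) x y * lin (p x) v).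
Proof.
move=> Nxy; have rvF := reg_dd false v rF; have rvvF := reg_dd false v rvF.
have rb := reg_bil rQ (regv_cst v) (regv_cst v).
have r1 := regM rvvF rly; have r2 := regM rvF (rl v).
rewrite (dd_eq (g := fun x y => 2 * bil (Q x) v v +
   (-1) * (dd false v (dd false v Fnav) x y * lin (p x) y + 2 * (dd false v Fnav
     x y * lin (p x) v))) _ Nxy);
  last by move=> x1 y1 N1; rewrite ddy_quad_kropina//; ring.
have r3 := regM (reg_cst J 2) r2.
rewrite (ddD (regM (reg_cst _ 2) rb) (regM (reg_cst _ (-1)) (regD r1 r3)) Nxy).
rewrite (ddZ rb Nxy) (ddZ (regD r1 r3) Nxy) (ddD r1 r3 Nxy) (ddM rvvF rly Nxy).
rewrite (ddZ r2 Nxy) (ddM rvF (rl v) Nxy) ddly// ddl//.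
rewrite (ddb false v (regv_cst v) (regv_cst v) Nxy) !ddv_cst !(bil0l, bil0r).
ring.
Qed.

End QuadraticPlusKropina.

(** * Parallel fields and the Berwald condition *)

Definition parallel x := forall u v, covW x u v = 0.

(** The Berwald condition for [navspray]. *)
Definition cubic_free := forall x y, N x y -> forall i j k l,
  partial false j (partial false k (partial false l (fun x y =>
    navspray x y 0 i))) x y = 0.

Lemma parallel_cubic_free : (forall x, base N x -> parallel x) -> cubic_free.
Proof.
move=> par x y Nxy i j k l.
pose Q x : 'M[R]_n := 2^-1 *: Gamma_mx i x.
have rQ a b : reg N J (fun x _ => Q x a b).
  apply: reg_eq (regM (reg_cst _ 2^-1) (reg_Gamma_mx i a b)) _ => x1 y1 _.
  by rewrite [RHS]mxE.
have GE : eq_dom N (fun x y => navspray x y 0 i) (fun x y => bil (Q x) y y).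
  move=> x1 y1 N1; have p1 := par _ (nav_base N1).
  have -> : navspray x1 y1 = 2^-1 *: Gamma x1 y1 y1.
    rewrite /navspray /spray_shift /radial !p1 mul0r subrr scale0r sub0r.
    have -> : curlW x1 y1 = 0.
      apply: (hprod_inj (nav_base N1)) => z;
        rewrite (hprod_curlW y1 z (nav_base N1)) !p1 subrr.
      by rewrite hprod_lin.
    by rewrite scaler0 oppr0 addr0.
  by rewrite mxE Gamma_bil /Q /bil -scalemxAr -scalemxAl [RHS]mxE.
pose e (k : 'I_n) : V := delta_mx 0 k.
have ry := @regv_y.
have E1 : eq_dom N (partial false l (fun x y => navspray x y 0 i))
    (fun x y => bil (Q x) (e l) y + bil (Q x) y (e l)).
  move=> x1 y1 N1; rewrite (partial_eq _ _ GE N1) -dd_delta (dd_bil _ _ rQ ry ry N1).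
  by rewrite ddv_y add0r.
have E2 : eq_dom N (partial false k (partial false l (fun x y => navspray x y 0 i)))
    (fun x y => bil (Q x) (e l) (e k) + bil (Q x) (e k) (e l)).
  move=> x1 y1 N1; rewrite (partial_eq _ _ E1 N1) -dd_delta.
  have r1 := reg_bil rQ (regv_cst (e l)) ry; have r2 :=
    reg_bil rQ ry (regv_cst (e l)).
  rewrite (ddD r1 r2 N1) (dd_bil _ _ rQ (regv_cst (e l)) ry N1).
  rewrite (dd_bil _ _ rQ ry (regv_cst (e l)) N1).
  by rewrite ddv_y ddv_cst bil0l bil0r !add0r addr0.
rewrite (partial_eq _ _ E2 Nxy) -dd_delta.
exact: (dd_xonly _ (fun x => bil (Q x) (e l) (e k) + bil (Q x) (e k) (e l))).
Qed.

Lemma cubic_free_dir v i x y : cubic_free -> N x y ->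
  dd false v (dd false v (dd false v (fun x y => navspray x y 0 i))) x y = 0.
Proof.
move=> cf Nxy; pose g x y := navspray x y 0 i.
have rg : reg N unrestricted g := reg_navspray i.
have swap s z h x1 y1 : reg N unrestricted h -> N x1 y1 ->
    dd s z (dd false v h) x1 y1 = \sum_k v 0 k * dd s z (partial false k h) x1 y1.
  move=> rh N1.
  rewrite (dd_eq (g := fun x y => \sum_k v 0 k * partial false k h x y) _ N1);
    last by move=> a b _; rewrite ddE.
  rewrite (dd_sum (J := unrestricted) _ N1).
    by apply: eq_bigr => k _; rewrite (ddZ (reg_partial false k rh) N1).
  by move=> k; apply: regM; [exact: reg_cst|exact: reg_partial].
rewrite swap//; last exact: reg_dd.
rewrite big1// => k _.
rewrite (dd_eq (g := fun x y =>
  \sum_l v 0 l * partial false k (partial false l g) x y) _ Nxy).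
  rewrite (dd_sum (J := unrestricted) _ Nxy); last first.
    by move=> l; apply: regM; [exact: reg_cst|do 2!apply: reg_partial].
  rewrite big1 ?mulr0// => l _.
  rewrite (ddZ (reg_partial false k (reg_partial false l rg)) Nxy) ddE big1
    ?mulr0// => j _.
  by rewrite cf// mulr0.
move=> x1 y1 N1; rewrite -dd_delta swap//.
by apply: eq_bigr => l _; rewrite dd_delta.
Qed.

Lemma W_decomposition x y : base N x ->
  exists (c : R) v, Wform x v = 0 /\ y = c *: Wfield x + v.
Proof.
move=> Ux; exists (Wform x y), (y - Wform x y *: Wfield x).
by rewrite !Wform_lin Wform_Wfield// mulr1 subrr addrC subrK.
Qed.

Lemma exists_perp x : (2 <= n)%N -> exists2 v, v != 0 & Wform x v = 0.
Proof.
move=> n2; pose i0 : 'I_n := Ordinal (leq_trans (isT : (1 <= 2)%N) n2).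
pose i1 : 'I_n := Ordinal n2.
have i01 : i1 != i0 by [].
pose e (k : 'I_n) : V := delta_mx 0 k.
have omE k : Wform x (e k) = Wcovec N x 0 k.
  by rewrite /Wform linE (bigD1 k)//= big1 ?addr0 => [|j /negbTE jk];
    rewrite mxE ?eqxx ?mulr1// jk andbF mulr0.
have e0 k : e k != 0.
  by apply/eqP => /rowP/(_ k); rewrite !mxE !eqxx => /eqP; rewrite oner_eq0.
have [W0|W0] := eqVneq (Wcovec N x 0 i0) 0.
  by exists (e i0); rewrite ?omE.
exists (Wcovec N x 0 i1 *: e i0 - Wcovec N x 0 i0 *: e i1); last first.
  by rewrite !Wform_lin !omE mulrC subrr.
apply/eqP => /rowP/(_ i1); rewrite !mxE !eqxx (negbTE i01) /= mulr0 add0r mulr1.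
by move=> /eqP; rewrite oppr_eq0 (negbTE W0).
Qed.

(** * Consequences of the curvature equation *)

Section Killing.
Variable K : V -> R.
Hypothesis flag_curvature : forall x y v i, N x y ->
  curv navspray v i x y = K x * (Fnav x y ^+ 2 * v 0 i - Fnav x y * dd false v
    Fnav x y * y 0 i).

Definition homog_defect v i x y : R := dd false y (dd false v (fun x y =>
  tame_spray x y 0 i)) x y
                 - dd false v (fun x y => tame_spray x y 0 i) x y.
Definition curv_excess v i x y : R :=
  curv tame_spray v i x y - K x * Fnav x y ^+ 2 * v 0 i.

(** The curvature equation multiplied by H^2 and contracted with a covector c that
    annihilates y: this removes the terms proportional to y, namely the one of
    [curv_projective] and the one containing dF. *)
Lemma pole_equation x y v (c : V) : N x y -> lin c y = 0 ->
  3 * lin c v * polar_num x y ^+ 2 + hprod x y y * (lin c v * simple_pole x y +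
    hprod x y y * (\sum_i c 0 i * curv_excess v i x y)
    - 2 * polar_num x y * (\sum_i c 0 i * homog_defect v i x y)) = 0.
Proof.
move=> Nxy cy.
have [al E] := curv_projective v (fun k =>
  reg_unrestricted (@regv_tame_spray k)) reg_polar Nxy
  (fun i => homog_tame_spray i Nxy) (homog_polar Nxy).
pose be := al + K x * Fnav x y * dd false v Fnav x y.
pose Xi := 2 * dd false (tame_spray x y) polar x y + polar x y ^+ 2 - dd true y
  polar x y.
have E2 i : curv_excess v i x y + y 0 i * be + v 0 i * Xi + 2 * polar x y *
  homog_defect v i x y = 0.
  have := E i; rewrite -(curv_eq v i (@navspray_split) Nxy) (flag_curvature v i
    Nxy) -/Xi -/(homog_defect v i x y).
  rewrite /curv_excess /be; move: (homog_defect v i x y) (curv _ _ _ _ _) (dd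
    false v Fnav x y) => b r f.
  by move=> h; rewrite -(subrr (K x * (Fnav x y ^+ 2 * v 0 i - Fnav x y * f * y 0 i)))
     [X in _ = X - _]h; ring.
have hX := polar_curvature Nxy; rewrite -/Xi in hX; clearbody be Xi.
have : (\sum_i c 0 i * curv_excess v i x y) + (\sum_i c 0 i * y 0 i) * be +
   (\sum_i c 0 i * v 0 i) * Xi + 2 * polar x y * (\sum_i c 0 i * homog_defect v i
     x y) = 0.
  rewrite !mulr_suml mulr_sumr -!big_split /= big1// => i _.
  by rewrite -(mulr0 (c 0 i)) -(E2 i);
    move: (curv_excess v i x y) (homog_defect v i x y) => *; ring.
rewrite -!linE cy mul0r.
have hP := polarE Nxy.
move: (\sum_i c 0 i * curv_excess v i x y) (\sum_i c 0 i * homog_defect v i x y)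
  => SC SB h.
transitivity (hprod x y y ^+ 2 * (SC + 0 + lin c v * Xi + 2 * polar x y * SB));
  last first.
  by rewrite h mulr0.
have -> : polar_num x y = - (polar x y * hprod x y y) by rewrite hP opprK.
have -> : hprod x y y ^+ 2 * (SC + 0 + lin c v * Xi + 2 * polar x y * SB) =
  hprod x y y ^+ 2 * (SC + 2 * polar x y * SB) + lin c v * (hprod x y y ^+ 2 *
    Xi) by ring.
rewrite hX; have -> : polar_num x y = - (polar x y * hprod x y y) by rewrite hP opprK.
ring.
Qed.

(** Along W + t v the equation [pole_equation] is polynomial in t, with
    H = 1 + q t^2 and rho = t D(v,W) + t^2 D(v,v), so [no_double_pole] applies. *)
Lemma covW_perp x v : base N x -> Wform x v = 0 ->
  covW x v (Wfield x) = 0 /\ covW x v v = 0.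
Proof.
move=> Ux v0; have [->|vn0] := eqVneq v 0.
  by rewrite -(scale0r 0) !(covW_lin Ux) !mul0r.
have Nx := Wfield_cone Ux; set q := hprod x v v.
have q0 : 0 < q := hmetric_posdef Ux vn0.
pose y t := Wfield x + t *: v.
have Ny t : N x (y t) by exact: cone_line.
have H_y t : hprod x (y t) (y t) = 1 + q * t ^+ 2.
  by rewrite /y !hprod_lin !hprod_Wfield// hprod_Wfieldr// Wform_Wfield// v0 -/q;
    ring.
have rho_y t : polar_num x (y t) = t * covW x v (Wfield x) + t ^+ 2 * covW x v v.
  by rewrite /polar_num /y !Wform_lin Wform_Wfield// v0 !(covW_lin Ux)
    !covW_Wfield//; ring.
(* The covector dual to v - t q W annihilates W + t v and takes the value q
   on v. *)
pose c t : V := v *m hmetric N x - (t * q) *: Wcovec N x.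
have cE t z : lin (c t) z = hprod x v z - t * q * Wform x z.
  by rewrite /c linDl -scaleNr linZl mulNr.
have cy t : lin (c t) (y t) = 0.
  by rewrite cE /y !hprod_lin !Wform_lin hprod_Wfieldr// Wform_Wfield// v0 -/q; ring.
have cv t : lin (c t) v = q by rewrite cE v0 -/q; ring.
have [pR hR] := choice (fun i => line_poly (@reg_curv i v) Nx v0).
have rB i : reg N J (homog_defect v i).
  have rA := reg_dd false v (@regv_tame_spray i).
  by apply: regB => //; apply: reg_ddv => // k; exact: reg_coord.
have [pB hB] := choice (fun i => line_poly (rB i) Nx v0).
have [pM hM] := line_poly (@reg_simple_pole) Nx v0.
have [pF hF] := line_poly reg_Fnav Nx v0.
pose pcoef i : {poly R} := ((v *m hmetric N x) 0 i)%:P - (q * Wcovec N x 0 i) *: 'X.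
pose pr : {poly R} := (covW x v (Wfield x)) *: 'X + (covW x v v) *: 'X^2.
pose p : {poly R} := q *: pM
  + (1 + q *: 'X^2) * (\sum_i pcoef i * (pR i - (K x * v 0 i) *: pF ^+ 2))
  - 2 *: pr * (\sum_i pcoef i * pB i).
apply: (no_double_pole (p := p) q0) => t.
have hc i : (c t) 0 i = (pcoef i).[t].
  rewrite /c /pcoef !(hornerD, hornerN, hornerZ, hornerC, hornerX).
  rewrite !mxE; congr (_ - _); ring.
rewrite -[RHS](pole_equation v (Ny t) (cy t)) cv rho_y H_y; congr (_ + _ * _).
rewrite /p !(hornerD, hornerN, hornerM, hornerZ, hornerC, hornerX, hornerXn,
  horner_sum).
rewrite -hM; congr (_ + _ * _ - _ * _).
- apply: eq_bigr => i _; rewrite hornerM -hc; congr (_ * _).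
  rewrite /curv_excess !(hornerD, hornerN, hornerZ, horner_exp) -hR -hF; ring.
- ring.
- by apply: eq_bigr => i _; rewrite hornerM -hc -hB.
Qed.

(** W is a Killing field. *)
Lemma covW_alt x y : base N x -> covW x y y = 0.
Proof.
move=> Ux; have [c [v [v0 ->]]] := W_decomposition y Ux.
have [h1 h2] := covW_perp Ux v0.
by rewrite !(covW_lin Ux) !(covW_Wfield _ Ux) h1 h2; ring.
Qed.

Lemma covW_anti x u v : base N x -> covW x u v = - covW x v u.
Proof.
move=> Ux; have := covW_alt (u + v) Ux.
rewrite !(covW_lin Ux) !(covW_alt _ Ux) add0r addr0 => h; lra.
Qed.

Lemma covW_Wfieldr x v : base N x -> covW x v (Wfield x) = 0.
Proof. by move=> Ux; rewrite covW_anti// covW_Wfield// oppr0. Qed.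

Lemma navspray_killing x y : N x y ->
  navspray x y = 2^-1 *: (Gamma x y y - Fnav x y *: curlW x y).
Proof.
move=> Nxy; have Ux := nav_base Nxy; rewrite /navspray /spray_shift /radial.
by rewrite covW_Wfieldr// covW_alt// mul0r subrr scale0r add0r.
Qed.

(** The skew-symmetric endomorphism y |-> covariant derivative of W along y. *)
Definition sigma x y : V := 2^-1 *: curlW x y.

Lemma hprod_sigma x y z : base N x -> hprod x (sigma x y) z = covW x z y.
Proof.
move=> Ux; rewrite /sigma; have := hprod_curlW y z Ux; move: (curlW x y) => S h.
by rewrite hprod_lin h (covW_anti y z Ux) opprK; field.
Qed.

Lemma sigmaD x u v : base N x -> sigma x (u + v) = sigma x u + sigma x v.
Proof.
move=> Ux; apply: (hprod_inj Ux) => z.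
by rewrite hprod_lin !hprod_sigma// (covW_lin Ux).
Qed.

Lemma sigmaZ x (a : R) v : base N x -> sigma x (a *: v) = a *: sigma x v.
Proof.
move=> Ux; apply: (hprod_inj Ux) => z.
by rewrite hprod_lin !hprod_sigma// (covW_lin Ux).
Qed.

Lemma sigma_Wfield x : base N x -> sigma x (Wfield x) = 0.
Proof.
move=> Ux; apply: (hprod_inj Ux) => z.
by rewrite hprod_sigma// covW_Wfieldr// hprod_lin.
Qed.

(** Contractions with a covector c of the two parts of the spray. *)
Definition quad_part (c : V) x : 'M[R]_n := \sum_i (c 0 i / 2) *: Gamma_mx i x.
Definition sigma_part (c : V) x : V := \sum_i (c 0 i / 2) *: curlW_row i x.

Lemma bil_quad_part (c : V) x u v : bil (quad_part c x) u v =
  2^-1 * lin c (Gamma x u v).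
Proof.
rewrite linE mulr_sumr.
transitivity (\sum_i (c 0 i / 2) * bil (Gamma_mx i x) u v); last first.
  by apply: eq_bigr => i _; rewrite Gamma_bil mulrAC mulrC mulrA.
rewrite /quad_part; elim/big_rec2 : _ => [|i a A _ <-].
  by rewrite /bil mulmx0 mul0mx mxE.
by rewrite /bil mulmxDr mulmxDl mxE -scalemxAr -scalemxAl [X in X + _]mxE.
Qed.

Lemma lin_sigma_part (c : V) x y : base N x -> lin (sigma_part c x) y =
  lin c (sigma x y).
Proof.
move=> Ux; rewrite [RHS]linE.
transitivity (\sum_i (c 0 i / 2) * lin (curlW_row i x) y); last first.
  by apply: eq_bigr => i _; rewrite [sigma _ _ _ _]mxE curlW_lin// mulrA.
rewrite /sigma_part; elim/big_rec2 : _ => [|i a A _ <-].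
  by rewrite /lin mul0mx mxE.
by rewrite linDl linZl.
Qed.

Lemma reg_quad_part (c : V) i j : reg N J (fun x _ => quad_part c x i j).
Proof.
apply: (@reg_eq _ _ _ _ (fun x _ => \sum_k (c 0 k / 2) * Gamma_mx k x i j)).
  by apply: reg_sum => k _; apply: regM; [exact: reg_cst|exact: reg_Gamma_mx].
by move=> x y _; rewrite /quad_part summxE; apply: eq_bigr => k _; rewrite [RHS]mxE.
Qed.

Lemma reg_sigma_part (c : V) i : reg N J (fun x _ => sigma_part c x 0 i).
Proof.
apply: (@reg_eq _ _ _ _ (fun x _ => \sum_k (c 0 k / 2) * curlW_row k x 0 i)).
  by apply: reg_sum => k _; apply: regM; [exact: reg_cst|exact: regv_curlW_row].
by move=> x y _; rewrite /sigma_part summxE; apply: eq_bigr => k _; rewrite [RHS]mxE.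
Qed.

Lemma regv_navspray : regv navspray.
Proof.
move=> k; have rg := regv_Gamma (@regv_y) (@regv_y) k.
have rs := @regv_curlW k.
apply: reg_eq (regM (reg_cst _ 2^-1) (regB rg (regM reg_Fnav rs))) _.
by move=> x y Nxy; rewrite navspray_killing// !mxE.
Qed.

Lemma lin_navspray (c : V) : eq_dom N (fun x y => lin c (navspray x y))
  (fun x y => bil (quad_part c x) y y - Fnav x y * lin (sigma_part c x) y).
Proof.
move=> x y Nxy; rewrite navspray_killing// bil_quad_part lin_sigma_part;
  last exact: nav_base Nxy.
by rewrite /sigma; move: (Gamma x y y) (curlW x y) => g S; rewrite !lin_rules; ring.
Qed.

Lemma ddv_navspray v x y : N x y -> ddv false v navspray x y =
  Gamma x v y - dd false v Fnav x y *: sigma x y - Fnav x y *: sigma x v.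
Proof.
move=> Nxy; have Ux := nav_base Nxy; apply: lin_inj => c; rewrite linC [RHS]linC.
have : dd false v (fun x y => lin c (navspray x y)) x y =
  lin c (ddv false v navspray x y).
  by rewrite (dd_lin false v (p := fun=> c) (regv_cst c) regv_navspray Nxy) add0r.
move=> <-; rewrite (dy_quad_kropina (reg_quad_part c) (reg_sigma_part c)
  (lin_navspray c) v Nxy).
rewrite !bil_quad_part !lin_sigma_part// (GammaC y v Ux).
by move: (sigma x y) (sigma x v) (Gamma x v y) => a b d; rewrite !lin_rules; field.
Qed.

(** The flag curvature equation along y = W + t v, with both free indices
    contracted with v, reads
    C(t) + |sigma v|^2 (1 - q^2 t^4) / 4 = K q (1 - q^2 t^4) / 4 with C of degree
    at most 3; compare the coefficients of t^4. *)
Lemma flag_curvature_sigma x v : base N x -> Wform x v = 0 -> v != 0 ->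
  hprod x (sigma x v) (sigma x v) = K x * hprod x v v.
Proof.
move=> Ux v0 vn0.
have Nx := Wfield_cone Ux; set q := hprod x v v.
have q0 : 0 < q := hmetric_posdef Ux vn0.
pose y t := Wfield x + t *: v.
have Ny t : N x (y t) by exact: cone_line.
set m := hprod x (sigma x v) (sigma x v).
have omy t : Wform x (y t) = 1 by rewrite /y !Wform_lin Wform_Wfield// v0; ring.
have Fy t : Fnav x (y t) = 2^-1 * (1 + q * t ^+ 2).
  have := FnavE (Ny t); rewrite omy /y !hprod_lin !hprod_Wfield// hprod_Wfieldr//
    Wform_Wfield// v0 -/q => h; lra.
have Fvy t : dd false v Fnav x (y t) = t * q.
  have := dy_Fnav v (Ny t); rewrite omy v0 /y !hprod_lin hprod_Wfield// v0 -/q =>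
    h; lra.
pose c : V := v *m hmetric N x.
have cE z : lin c z = hprod x v z by [].
have pE z : lin (sigma_part c x) z = covW x v z.
  by rewrite lin_sigma_part// cE hprodC// hprod_sigma.
have pv : lin (sigma_part c x) v = 0 by rewrite pE covW_alt.
have py t : lin (sigma_part c x) (y t) = 0.
  by rewrite pE /y !(covW_lin Ux) covW_Wfieldr// covW_alt//; ring.
have psv : lin (sigma_part c x) (sigma x v) = - m.
  by rewrite pE covW_anti// -hprod_sigma.
have sy t : sigma x (y t) = t *: sigma x v.
  by rewrite /y sigmaD// sigmaZ// sigma_Wfield// add0r.
have Gy t : navspray x (y t) =
  2^-1 *: Gamma x (y t) (y t) - (t * Fnav x (y t)) *: sigma x v.
  rewrite navspray_killing// scalerBr; congr (_ - _).
  have -> : curlW x (y t) = (2 * t) *: sigma x v.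
    by rewrite -scalerA -sy /sigma scalerA mulfV ?scale1r// pnatr_eq0.
  by rewrite !scalerA; congr (_ *: _); field.
have Zy t : ddv false v navspray x (y t) =
    Gamma x v (y t) - (t ^+ 2 * q + Fnav x (y t)) *: sigma x v.
  rewrite ddv_navspray// Fvy sy scalerA -addrA -opprD -scalerDl;
    congr (_ - _ *: _); ring.
set Q := quad_part c x; set p := sigma_part c x.
pose dQ z := dquad (quad_part c) x z; pose dp z := drow (sigma_part c) x z.
(* C is the curvature without the two terms in which sigma is applied twice:
   [sigma_part] evaluated at the sigma-term of the spray, and at that of the
   derivative of the spray in direction v. *)
pose C t : R :=
  2 * (bil (dQ v) (y t) (y t) - Fnav x (y t) * lin (dp v) (y t))
  - ((bil (dQ (y t)) v (y t) + bil (dQ (y t)) (y t) v)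
     - (t * q * lin (dp (y t)) (y t) + Fnav x (y t) * lin (dp (y t)) v))
  + 2 * (bil Q v (2^-1 *: Gamma x (y t) (y t)) + bil Q (2^-1 *: Gamma x (y t) (y t)) v
     - t * Fnav x (y t) * (bil Q v (sigma x v) + bil Q (sigma x v) v)
     - t * q * lin p (2^-1 *: Gamma x (y t) (y t)))
  - (bil Q (Gamma x v (y t)) (y t) + bil Q (y t) (Gamma x v (y t))
     - (t ^+ 2 * q + Fnav x (y t)) * (bil Q (sigma x v) (y t) + bil Q (y t)
         (sigma x v))
     - Fnav x (y t) * lin p (Gamma x v (y t))).
have key t : C t = (4^-1 * (K x * q - m)) * (1 - q ^+ 2 * t ^+ 4).
  have := curv_contract c v regv_navspray (Ny t).
  rewrite (dx_quad_kropina (reg_quad_part c) (reg_sigma_part c) (lin_navspray c)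
    v (Ny t)).
  rewrite !(ddy_quad_kropina (reg_quad_part c) (reg_sigma_part c) (lin_navspray
    c) _ _ v (Ny t)).
  rewrite (dy_quad_kropina (reg_quad_part c) (reg_sigma_part c) (lin_navspray c)
    _ (Ny t)).
  have -> : \sum_i c 0 i * curv navspray v i x (y t) =
      K x * (Fnav x (y t) ^+ 2 * q - Fnav x (y t) * (t * q) * (t * q)).
    transitivity (K x * (Fnav x (y t) ^+ 2 * lin c v - Fnav x (y t) * dd false v
      Fnav x (y t) * lin c (y t))).
      rewrite !linE !mulr_sumr -sumrB mulr_sumr.
      by apply: eq_bigr => i _; rewrite (flag_curvature v i (Ny t)); ring.
    by rewrite Fvy !cE -/q /y !hprod_lin hprod_Wfieldr// v0 -/q add0r.
  rewrite pv py Fvy Gy Zy /C; clear C.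
  rewrite -/p -/Q -/(dQ v) -/(dQ (y t)) -/(dp v) -/(dp (y t)).
  move: (dp v) (dp (y t)) (dQ v) (dQ (y t)) (Gamma x (y t) (y t)) (Gamma x v (y
    t)) Q => dpv dpy dQv dQy g1 g2 Q1.
  move: psv; rewrite -/p; move: p => p1;
    move: (sigma x v) (y t) (dd true (y t) _ _ _) (Fy t).
  move=> S y1 A B; rewrite !bil_rules !lin_rules => ->; rewrite !B => h.
  lra.
have vy : vdeg 1 y by exact: vdeg_line.
have dd_Fnav : pdeg 2 (fun t => Fnav x (y t)).
  have [p1 sp hp] : pdeg 2 (fun t => 2^-1 * (1 + q * (t * t))).
    apply: (@pdegM _ 0 2); first exact: pdeg_cst.
    apply: pdegD; first exact: pdeg_cst.
    apply: (@pdegM _ 0 2); first exact: pdeg_cst.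
    by apply: (@pdegM _ 1 1); exact: pdeg_id.
  by exists p1 => // t; rewrite Fy -hp; ring.
have vg u e (w : R -> V) : vdeg e w -> vdeg e (fun t => Gamma x (u : V) (w t)).
  move=> dw i; have [p1 sp hp] := pdeg_bil (Gamma_mx i x) (vdeg_cst 0 u) dw.
  by exists p1 => // t; rewrite Gamma_bil hp.
have vgg : vdeg 2 (fun t => 2^-1 *: Gamma x (y t) (y t)).
  move=> i; have [p1 sp hp] := pdegM (pdeg_cst 0 2^-1) (pdeg_bil (Gamma_mx i x)
    vy vy).
  by exists p1 => // t; rewrite mxE Gamma_bil hp.
have dQE t (a b : V) : bil (dQ (y t)) a b =
  bil (dQ (Wfield x)) a b + t * bil (dQ v) a b.
  rewrite /y /dQ; have -> : dquad (quad_part c) x (Wfield x + t *: v) =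
    dquad (quad_part c) x (Wfield x) + t *: dquad (quad_part c) x v.
    by apply/matrixP => i j; rewrite !mxE dd_vD dd_vZ.
  by rewrite /bil mulmxDr mulmxDl -scalemxAr -scalemxAl [LHS]mxE; congr (_ + _);
    rewrite mxE.
have dpE t (a : V) : lin (dp (y t)) a = lin (dp (Wfield x)) a + t * lin (dp v) a.
  rewrite /y /dp; have -> : drow (sigma_part c) x (Wfield x + t *: v) =
    drow (sigma_part c) x (Wfield x) + t *: drow (sigma_part c) x v.
    by apply/rowP => i; rewrite !mxE dd_vD dd_vZ.
  by rewrite linDl linZl.
have dC : pdeg 3 C.
  have w23 f : pdeg 2 f -> pdeg 3 f by exact: pdeg_weak.
  have idq : pdeg 1 (fun t => t * q) by apply: (@pdegM _ 1 0) pdeg_id (pdeg_cst _ _).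
  have cst d (k : R) : pdeg d (fun=> k) := pdeg_cst d k.
  have cv d : vdeg d (fun=> v) := vdeg_cst d v.
  have cs d : vdeg d (fun=> sigma x v) := vdeg_cst d _.
  have dl u : pdeg 1 (fun t => lin u (y t)) := pdeg_lin u vy.
  apply: pdegB; [apply: pdegD; [apply: pdegB|]|].
  - apply: (@pdegM _ 0 3) => //; apply: pdegB.
      exact/w23/(pdeg_bil _ vy vy).
    exact: (@pdegM _ 2 1).
  - apply: pdegB.
      have [p1 sp hp] : pdeg 3 (fun t =>
        (bil (dQ (Wfield x)) v (y t) + t * bil (dQ v) v (y t))
          + (bil (dQ (Wfield x)) (y t) v + t * bil (dQ v) (y t) v)).
        have b1 A : pdeg 1 (fun t => bil A v (y t)) := pdeg_bil A (cv 0) vy.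
        have b2 A : pdeg 1 (fun t => bil A (y t) v) := pdeg_bil A vy (cv 0).
        apply: w23; apply: pdegD; apply: pdegD.
        + exact: pdeg_weak (b1 _).
        + exact: (@pdegM _ 1 1 _ _ (pdeg_id)).
        + exact: pdeg_weak (b2 _).
        + exact: (@pdegM _ 1 1 _ _ (pdeg_id)).
      by exists p1 => // t; rewrite !dQE hp.
    have [p1 sp hp] : pdeg 3 (fun t =>
      t * q * (lin (dp (Wfield x)) (y t) + t * lin (dp v) (y t))
        + Fnav x (y t) * (lin (dp (Wfield x)) v + t * lin (dp v) v)).
      apply: pdegD.
        apply: (@pdegM _ 1 2) => //; apply: pdegD; first exact: pdeg_weak (dl _).
        exact: (@pdegM _ 1 1 _ _ (pdeg_id)).
      apply: (@pdegM _ 2 1) => //; apply: pdegD => //.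
      exact: (@pdegM _ 1 0 _ _ (pdeg_id)).
    by exists p1 => // t; rewrite !dpE hp.
  - apply: (@pdegM _ 0 3) => //; apply: pdegB; [apply: pdegB|].
    + apply: w23; apply: pdegD; [exact: (pdeg_bil _ (cv 0) vgg)|exact: (pdeg_bil
      _ vgg (cv 0))].
    + apply: (@pdegM _ 3 0) => //; exact: (@pdegM _ 1 2 _ _ (pdeg_id)).
    + apply: (@pdegM _ 1 2) => //; exact: pdeg_lin.
  - have b1 : vdeg 1 (fun t => Gamma x v (y t)) := vg v 1 _ vy.
    apply: pdegB; [apply: pdegB|].
    + apply: w23; apply: pdegD; [exact: (pdeg_bil _ b1 vy)|exact: (pdeg_bil _ vy b1)].
    + apply: (@pdegM _ 2 1).
        apply: pdegD => //; apply: (@pdegM _ 2 0) => //.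
        have [p1 sp hp] := pdegM (@pdeg_id R) (@pdeg_id R).
        by exists p1 => // t; rewrite expr2 hp.
      apply: pdegD; [exact: (pdeg_bil _ (cs 0) vy)|exact: (pdeg_bil _ vy (cs 0))].
    + apply: (@pdegM _ 2 1) => //; exact: pdeg_lin.
have := no_quartic_term dC (lt0r_neq0 q0) key; lra.
Qed.

(** D(u,y) = h(sigma(y),u), and sigma(W) = 0. *)
Lemma sigma_parallel x : base N x ->
  (forall v, Wform x v = 0 -> sigma x v = 0) -> parallel x.
Proof.
move=> Ux h u y; have [c [v [v0 ->]]] := W_decomposition y Ux.
rewrite !(covW_lin Ux) covW_Wfieldr// mulr0 add0r -hprod_sigma// h//.
by rewrite hprod_lin.
Qed.

(** The quadratic part and all but one term of F sigma disappear in the third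
    derivative at y = W in the direction v: sigma(W) = 0 there, and the second
    derivative of F in the direction v is |v|^2. *)
Lemma cubic_free_parallel x : cubic_free -> base N x -> parallel x.
Proof.
move=> cf Ux; apply: sigma_parallel => // v v0.
have [->|vn0] := eqVneq v 0; first by rewrite -(scale0r 0) sigmaZ// !scale0r.
have q0 : 0 < hprod x v v := hmetric_posdef Ux vn0.
have Nx := Wfield_cone Ux.
have Fvv : dd false v (dd false v Fnav) x (Wfield x) = hprod x v v.
  have := dyy_Fnav v v Nx; rewrite Wform_Wfield// v0; lra.
apply/rowP => i; rewrite [RHS]mxE.
pose c : V := delta_mx 0 i.
have fE : eq_dom N (fun x y => navspray x y 0 i)
    (fun x y => bil (quad_part c x) y y - Fnav x y * lin (sigma_part c x) y).
  by move=> x1 y1 N1; rewrite -(lin_navspray c N1) lin_delta.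
have := dyyy_quad_kropina (reg_quad_part c) (reg_sigma_part c) fE v Nx.
rewrite cubic_free_dir// Fvv !lin_sigma_part// sigma_Wfield// lin0 lin_delta
  mulr0 add0r.
move=> /esym/eqP; rewrite oppr_eq0 !mulf_eq0 pnatr_eq0 (gt_eqF q0)/= => /eqP.
done.
Qed.

Lemma flag0_parallel x : base N x -> K x = 0 -> parallel x.
Proof.
move=> Ux K0; apply: sigma_parallel => // v v0.
have [->|vn0] := eqVneq v 0; first by rewrite -(scale0r 0) sigmaZ// !scale0r.
have := flag_curvature_sigma Ux v0 vn0; rewrite K0 mul0r => h.
apply/eqP/negPn/negP => s0; have := hmetric_posdef Ux s0.
by rewrite -/(hprod x _ _) h ltxx.
Qed.

Lemma parallel_flag0 x : (2 <= n)%N -> base N x -> parallel x -> K x = 0.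
Proof.
move=> n2 Ux par; have [v vn0 v0] := exists_perp x n2.
have := flag_curvature_sigma Ux v0 vn0; rewrite hprod_sigma// par => /esym/eqP.
by rewrite mulf_eq0 (gt_eqF (hmetric_posdef Ux vn0)) orbF => /eqP.
Qed.

End Killing.

End Nav.

(** * Navigation data of a Kropina metric *)

Section KropinaData.
Context {R : realType} {n : nat}.
Notation V := 'rV[R]_n.
Variables (U : set V) (a : V -> 'M[R]_n) (b : V -> V).
Hypothesis U_open : open U.
Hypothesis a_smooth : forall k l, smooth_on U (fun x => a x k l).
Hypothesis b_smooth : forall k, smooth_on U (fun x => b x 0 k).
Hypothesis a_sym : forall x, U x -> (a x)^T = a x.
Hypothesis a_pos : forall x, U x -> forall y, y != 0 -> 0 < bil (a x) y y.
Hypothesis b_neq0 : forall x, U x -> b x != 0.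
Implicit Types x y z v : V.

Lemma beta_lin x y : beta b x y = lin (b x) y.
Proof. by rewrite linE. Qed.

Lemma differentiable_beta_x x y : U x -> differentiable (fun x => beta b x y : R^o) x.
Proof.
move=> Ux.
have -> : (fun x => beta b x y : R^o) = \sum_(i < n) (fun x => b x 0 i * y 0 i : R^o).
  by apply/funext => z; rewrite fct_sumE.
apply: differentiable_sum => i; apply: differentiableM => //.
exact: (@b_smooth i [::] x Ux).
Qed.

Lemma differentiable_beta_y x y : differentiable (beta b x : V -> R^o) y.
Proof.
have -> : (beta b x : V -> R^o) = \sum_(i < n) (fun y => b x 0 i * y 0 i : R^o).
  by apply/funext => z; rewrite fct_sumE.
apply: differentiable_sum => i; apply: differentiableM => //.
exact: differentiable_coord.
Qed.

Definition kropina_cone x y := U x /\ 0 < beta b x y.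

Lemma kropina_cone_nearx x y : kropina_cone x y -> \forall x' \near x,
  kropina_cone x' y.
Proof.
move=> [Ux b0]; have cb := differentiable_continuous (differentiable_beta_x y Ux).
near=> x'; split.
  by near: x'; exact: open_nbhs_nbhs.
by near: x'; exact: (cvgr_gt _ cb).
Unshelve. all: by end_near. Qed.

Lemma kropina_cone_neary x y : kropina_cone x y -> \forall y' \near y,
  kropina_cone x y'.
Proof.
move=> [Ux b0]; have cb := differentiable_continuous (differentiable_beta_y x y).
near=> y'; split => //.
by near: y'; exact: (cvgr_gt _ cb).
Unshelve. all: by end_near. Qed.

Lemma kropina_cone_base x y : kropina_cone x y -> U x.
Proof. by case. Qed.

Definition kropina_conic :=
  ConicDomain kropina_cone_base kropina_cone_nearx kropina_cone_neary.

Let J := ker_invariant U (nav_form a b).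

Lemma a_unit x : U x -> a x \in unitmx.
Proof. by move=> Ux; apply: posdef_unit; exact: a_pos. Qed.

Lemma sqnorm_bE x : sqnorm_b a b x = bil (invmx (a x)) (b x) (b x).
Proof. by rewrite bilE. Qed.

(** If b = z a then the squared norm of b is a(z,z). *)
Lemma sqnorm_b_gt0 x : U x -> 0 < sqnorm_b a b x.
Proof.
move=> Ux; have aU := a_unit Ux; rewrite sqnorm_bE.
pose z := b x *m invmx (a x).
have zb : z *m a x = b x by rewrite /z mulmxKV.
have -> : bil (invmx (a x)) (b x) (b x) = bil (a x) z z.
  rewrite /bil -/z -[in LHS]zb trmx_mul a_sym//.
  by rewrite mulmxA.
apply: a_pos => //; apply: contra_neq (b_neq0 Ux) => z0.
by rewrite -zb z0 mul0mx.
Qed.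

Lemma reg_a k l : reg kropina_conic J (fun x _ => a x k l).
Proof. exact: (@reg_smooth _ _ kropina_conic J (fun x => a x k l)). Qed.
Lemma reg_b k : reg kropina_conic J (fun x _ => b x 0 k).
Proof. exact: (@reg_smooth _ _ kropina_conic J (fun x => b x 0 k)). Qed.

(** On the domain, exp(kappa) is 4 divided by the squared norm of b, a rational
    expression in the coefficients of a and b. *)
Lemma reg_expR_kappa : reg kropina_conic J (fun x _ => expR (kappa a b x)).
Proof.
have ri k l : reg kropina_conic J (fun x _ => invmx (a x) k l).
  by apply: reg_invmx; [exact: reg_a|move=> x Ux|move=> x y [Ux _]; exact: a_unit].
have rs : reg kropina_conic J (fun x _ => sqnorm_b a b x).
  apply: reg_sum => i _; apply: reg_sum => j _.
  by apply: regM; [apply: regM; [exact: ri|exact: reg_b]|exact: reg_b].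
have s0 x y : kropina_conic x y -> sqnorm_b a b x != 0.
  by move=> [Ux _]; rewrite gt_eqF// sqnorm_b_gt0.
apply: reg_eq (regM (reg_cst _ 4) (regV rs _ s0)) _ => [x Ux//|x y [Ux _]].
have := kappaE (sqnorm_b_gt0 Ux) => <-.
by rewrite mulfK// gt_eqF// sqnorm_b_gt0.
Qed.

Fact kropina_hmetric_reg i j :
  reg kropina_conic (ker_invariant (base kropina_conic) (nav_form a b))
    (fun x _ => nav_metric a b x i j).
Proof.
apply: reg_eq (regM reg_expR_kappa (reg_a i j)) _ => x y _.
by rewrite mxE.
Qed.

Fact kropina_Wcovec_reg i :
  reg kropina_conic (ker_invariant (base kropina_conic) (nav_form a b))
    (fun x _ => nav_form a b x 0 i).
Proof.
apply: reg_eq (regM (regM reg_expR_kappa (reg_cst _ 2^-1)) (reg_b i)) _ => x y _.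
by rewrite mxE.
Qed.

Lemma lin_nav_form x y :
  lin (nav_form a b x) y = expR (kappa a b x) / 2 * beta b x y.
Proof. by rewrite beta_lin linZl. Qed.

Fact kropina_nav_coneP x y :
  kropina_conic x y <-> base kropina_conic x /\ 0 < lin (nav_form a b x) y.
Proof.
rewrite lin_nav_form pmulr_rgt0//; by rewrite divr_gt0 ?expR_gt0.
Qed.

Lemma bil_nav_metric x u v :
  bil (nav_metric a b x) u v = expR (kappa a b x) * bil (a x) u v.
Proof. by rewrite /bil -scalemxAr -scalemxAl mxE. Qed.

Fact kropina_hmetric_sym x : base kropina_conic x ->
  (nav_metric a b x)^T = nav_metric a b x.
Proof. by move=> Ux; rewrite /nav_metric linearZ/= a_sym. Qed.

Fact kropina_hmetric_posdef x : base kropina_conic x ->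
  forall y, y != 0 -> 0 < bil (nav_metric a b x) y y.
Proof.
by move=> Ux y y0; rewrite bil_nav_metric mulr_gt0 ?expR_gt0// a_pos.
Qed.

Fact kropina_Wcovec_unit x : base kropina_conic x ->
  bil (invmx (nav_metric a b x)) (nav_form a b x) (nav_form a b x) = 1.
Proof.
move=> Ux; have k0 := expR_gt0 (kappa a b x).
rewrite /nav_metric invmxZ; last by apply: posdef_unit; exact: kropina_hmetric_posdef.
rewrite /nav_form; have := kappaE (sqnorm_b_gt0 Ux); rewrite sqnorm_bE.
move: (expR _) k0 => e e0 h.
rewrite bilZl bilZr /bil -scalemxAr -scalemxAl mxE -/(bil _ _ _).
transitivity (4^-1 * (e * bil (invmx (a x)) (b x) (b x))).
  by field; rewrite gt_eqF.
by rewrite h mulVf// pnatr_eq0.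
Qed.

Definition kropina_nav : navData R n :=
  NavData kropina_hmetric_reg kropina_Wcovec_reg kropina_nav_coneP kropina_hmetric_sym
    kropina_hmetric_posdef kropina_Wcovec_unit.
Notation N := kropina_nav.

(** The factor exp(kappa) cancels from H / (2w). *)
Lemma kropinaE : eq_dom N (kropina a b) (Fnav N).
Proof.
move=> x y Nxy; have [Ux b0] := Nxy.
have y0 : y != 0.
  by apply: contraTneq b0 => ->; rewrite beta_lin lin0 ltxx.
rewrite /kropina /alpha -bilE sqr_sqrtr; last exact/ltW/a_pos.
rewrite /Fnav /hprod /Wform /= bil_nav_metric lin_nav_form.
by field; rewrite ?gt_eqF ?expR_gt0.
Qed.

Lemma nav_fieldE x : U x -> nav_field a b x = Wfield N x.
Proof.
move=> Ux; apply/rowP => i; rewrite mxE.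
by rewrite (@raise_delta _ _ N x _ i Ux).
Qed.

Lemma cov_derivative_parallel x : U x ->
  (forall i j, cov_derivative (nav_metric a b) (nav_field a b) i j x = 0) <->
  parallel N x.
Proof.
move=> Ux.
have E i j : cov_derivative (nav_metric a b) (nav_field a b) i j x =
    cov_derivative (hmetric N) (Wfield N) i j x.
  rewrite /cov_derivative; congr (_ + _).
    apply: near_eq_derive; near=> x1; rewrite nav_fieldE//.
    by near: x1; exact: open_nbhs_nbhs.
  by apply: eq_bigr => k _; rewrite nav_fieldE.
split=> [h u v|par i j].
  rewrite (basis_expansion (f := fun v => covW N x u v)); [|by move=> *;
    rewrite covW_lin..].
  rewrite big1// => j _; rewrite -cov_derivativeE//.
  rewrite (_ : \row_k _ = 0) ?mul0mx; first by rewrite /lin mul0mx mxE mul0r.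
  by apply/rowP => k; rewrite !mxE -E h.
rewrite E; have : \row_k cov_derivative (hmetric N) (Wfield N) k j x *m hmetric N
  x = 0.
  by apply: lin_inj => v; rewrite cov_derivativeE// par /lin mul0mx mxE.
move=> /(congr1 (mulmx^~ (invmx (hmetric N x)))); rewrite mulmxK ?mul0mx;
  last exact: hmetric_unitmx.
by move=> /rowP/(_ i); rewrite !mxE.
Unshelve. all: by end_near. Qed.

(** Contraction of the flag curvature equation with v^k. *)
Lemma flag_contract (K : V -> R) :
  scalar_flag_curvature_on (kropina a b) [set z | U z.1 /\ 0 < beta b z.1 z.2]
    (fun x _ => K x) ->
  forall x y v i, N x y -> curv (navspray N) v i x y =
    K x * (Fnav N x y ^+ 2 * v 0 i - Fnav N x y * dd false v (Fnav N) x y * y 0 i).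
Proof.
move=> HK x y v i Nxy; rewrite -(riemann_curv v i kropinaE Nxy).
have E k : partial false k (kropina a b) x y = partial false k (Fnav N) x y.
  exact: (partial_eq false k kropinaE Nxy).
under eq_bigr => k _ do rewrite (HK x y Nxy i k) -[pd k _ y]/(partial false k
  (kropina a b) x y)
  E (kropinaE Nxy).
rewrite ddE (_ : Fnav N x y ^+ 2 * v 0 i =
  \sum_k Fnav N x y ^+ 2 * (i == k)%:R * v 0 k).
  rewrite mulr_sumr mulr_suml -sumrB mulr_sumr.
  by apply: eq_bigr => k _; ring.
rewrite (bigD1 i)//= eqxx mulr1 big1 ?addr0// => k /negbTE ki.
by rewrite eq_sym ki mulr0 mul0r.
Qed.

Lemma berwald_cubic_free :
  berwald_on (kropina a b) [set z | U z.1 /\ 0 < beta b z.1 z.2] <-> cubic_free N.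
Proof.
have S i : eq_dom N (spray (kropina a b) i) (fun x y => navspray N x y 0 i).
  by move=> x y Nxy; rewrite (spray_eq i kropinaE Nxy) spray_Fnav.
have S3 i j k l : eq_dom N (partial false j (partial false k (partial false l
  (spray (kropina a b) i))))
   (partial false j (partial false k (partial false l (fun x y =>
     navspray N x y 0 i)))).
  by do 3 apply: partial_eq.
split=> h x y Nxy i j k l; first by rewrite -S3//; exact: h.
have := h x y Nxy i j k l; rewrite -S3//.
Qed.

End KropinaData.

Theorem theorem4p4 (R : realType) (n : nat) (hn : (2 <= n)%N)
  (M : smoothManifold R n) (a : riemannianMetric M) (b : oneForm M)
  (hb : nowhere_vanishing b) (K : M -> R)
  (hK : kropina_p_scalar_flag_curvature a b K) :
  (kropina_berwald a b <-> nav_field_parallel a b) /\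
  (kropina_berwald a b <-> forall p : M, K p = 0).
Proof.
have U_open (c : chart M) : open (chart_img c) by exact: img_open.
have a_pos (c : chart M) x : chart_img c x ->
    forall y, y != 0 -> 0 < bil (a c x) y y.
  by move=> Ux y y0; rewrite bilE; exact: metric_posdef.
have b_neq0 (c : chart M) x : chart_img c x -> b c x != 0 by exact: hb.
have a_smooth (c : chart M) := @metric_smooth _ _ _ a c.
have b_smooth (c : chart M) := @form_smooth _ _ _ b c.
have a_sym (c : chart M) := @Defs.metric_sym _ _ _ a c.
pose N c := kropina_nav (U_open c) (a_smooth c) (b_smooth c) (a_sym c)
  (a_pos c) (b_neq0 c).
have flag_curvature c := @flag_contract _ _ _ _ _ (U_open c) (a_smooth c)
  (b_smooth c) (a_sym c)
  (a_pos c) (b_neq0 c) _ (hK c).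
have BC c := @berwald_cubic_free _ _ _ _ _ (U_open c) (a_smooth c) (b_smooth c)
  (a_sym c)
  (a_pos c) (b_neq0 c).
have CP c x := @cov_derivative_parallel _ _ _ _ _ (U_open c) (a_smooth c)
  (b_smooth c) (a_sym c) (a_pos c) (b_neq0 c) x.
have BP : kropina_berwald a b <-> forall c x, chart_img c x -> parallel (N c) x.
  split=> [h c x Ux|h c].
    exact: (cubic_free_parallel (flag_curvature c) (proj1 (BC c) (h c)) Ux).
  exact: (proj2 (BC c) (@parallel_cubic_free _ _ (N c) (h c))).
split; split.
- by move=> /BP h c x Ux; exact: (proj2 (CP c x Ux) (h c x Ux)).
- by move=> h; apply/BP => c x Ux; exact: (proj1 (CP c x Ux) (h c x Ux)).
- move=> /BP h p; have [c cp] := dom_cover p.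
  have Ux : chart_img c (Defs.coord c p) by exists p.
  by rewrite -(coordK cp); exact: (@parallel_flag0 _ _ (N c) _ (flag_curvature c)
    _ hn Ux (h c _ Ux)).
- by move=> h; apply/BP => c x Ux;
    exact: (@flag0_parallel _ _ (N c) _ (flag_curvature c) _ Ux (h _)).
Qed.
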